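(* The solution of the HDG scheme with the convex splitting $f^n(u_h^n)=(u_h^n)^3-u_h^{n-1}$ is unique. The solution of the HDG scheme with the backward Euler discretization $f^n(u_h^n)=(u_h^n)^3-u_h^n$ is unique provided $\Delta t\le C\epsilon^3$, where $C>0$ is a constant independent of $h$, $\Delta t$ and $\epsilon$. Here the HDG scheme reads: for $n=1,\dots,N$ find $(\bm p_h^n,\phi_h^n,\widehat\phi_h^n),(\bm q_h^n,u_h^n,\widehat u_h^n)\in\bm V_h\times W_h\times M_h$ such that $$(\partial_t^+u_h^n,w_1)_{\mathcal T_h}+\mathcal A(\bm p_h^n,\phi_h^n,\widehat\phi_h^n;\bm r_1,w_1,\mu_1)=0,$$ $$(\epsilon^{-1}f^n(u_h^n),w_2)_{\mathcal T_h}+\epsilon\mathcal A(\bm q_h^n,u_h^n,\widehat u_h^n;\bm r_2,w_2,\mu_2)-(\phi_h^n,w_2)_{\mathcal T_h}=0,$$ for all $(\bm r_1,w_1,\mu_1),(\bm r_2,w_2,\mu_2)\in\bm V_h\times W_h\times M_h$, with $u_h^0\in W_h$ the $L^2(\Omega)$ projection of $u^0$ onto $W_h$.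
   Context: $\Omega\subset\mathbb R^d$ ($d=2,3$) is a bounded polygonal/polyhedral domain with Lipschitz boundary, $\epsilon>0$, $T>0$, $u^0\in L^2(\Omega)$ the given initial datum, $N\ge1$ an integer, $\Delta t=T/N$, $\partial_t^+u_h^n=(u_h^n-u_h^{n-1})/\Delta t$. $\mathcal T_h$ is a shape-regular, quasi-uniform simplicial triangulation of $\Omega$ with mesh size $h$, $h_K$ the diameter of $K$, $\mathcal E_h$ the set of all faces. $(w,v)_{\mathcal T_h}=\sum_K\int_Kwv$, $\langle\zeta,\rho\rangle_{\partial\mathcal T_h}=\sum_K\int_{\partial K}\zeta\rho$; differential operators act elementwise; $\bm n$ is the outward unit normal to $K$. For an integer $k\ge0$: $\bm V_h=\{\bm v\in[L^2(\Omega)]^d:\bm v|_K\in[\mathcal P^k(K)]^d\ \forall K\}$, $W_h=\{w\in L^2(\Omega):w|_K\in\mathcal P^{k+1}(K)\ \forall K\}$, $M_h=\{\mu\in L^2(\mathcal E_h):\mu|_E\in\mathcal P^k(E)\ \forall E\in\mathcal E_h\}$. $\Pi_k^\partial$ is the $L^2$ projection onto $\mathcal P^k(E)$ on each face $E$ of each $K$ (applied to traces from $K$). The operator $\mathcal A$ is $$\mathcal A(\bm q_h,u_h,\widehat u_h;\bm r_h,w_h,\mu_h)=(\bm q_h,\bm r_h)_{\mathcal T_h}-(u_h,\nabla\cdot\bm r_h)_{\mathcal T_h}+\langle\widehat u_h,\bm r_h\cdot\bm n\rangle_{\partial\mathcal T_h}+(\nabla\cdot\bm q_h,w_h)_{\mathcal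 T_h}-\langle\bm q_h\cdot\bm n,\mu_h\rangle_{\partial\mathcal T_h}+\langle h_K^{-1}(\Pi_k^\partial u_h-\widehat u_h),\Pi_k^\partial w_h-\mu_h\rangle_{\partial\mathcal T_h}.$$ *)

(* Defs.v *)
From HB Require Import structures.
From mathcomp Require Import all_boot all_order all_algebra.
From mathcomp Require Import all_classical all_reals all_analysis.
From mathcomp Require mpoly.

Set Implicit Arguments.
Unset Strict Implicit.
Unset Printing Implicit Defensive.
Import Order.TTheory GRing.Theory Num.Theory.
Import numFieldNormedType.Exports.
Local Open Scope classical_set_scope.
Local Open Scope ring_scope.

(* Lebesgue measure on R^n, by recursion on n: the image of the product of the
   Lebesgue measures on R and on R^n under (x, t) |-> x :: t. The carrier is
   the type of n-tuples, whose sigma-algebra is the product (Borel) one. *)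
Section lebesgue_tuple_step.
Context (R : realType) (n : nat).
Let T := measurableTypeR R.
Variable mu : {sigma_finite_measure set (n.-tuple T) -> \bar R}.
Local Open Scope ereal_scope.

Definition tcons (p : T * n.-tuple T) : n.+1.-tuple T := [tuple of p.1 :: p.2].
Definition tuncons (t : n.+1.-tuple T) : T * n.-tuple T :=
  (thead t, [tuple of behead t]).

Lemma tconsK : cancel tcons tuncons.
Proof. by move=> [x t]; congr (_, _); exact: val_inj. Qed.

Lemma measurable_tcons : measurable_fun setT tcons.
Proof. exact: (measurable_cons measurable_fst measurable_snd). Qed.

Lemma measurable_tuncons : measurable_fun setT tuncons.
Proof.
apply: measurable_fun_pair; first exact: measurable_tnth.
exact: measurable_behead.
Qed.

Definition leb_cons (A : set (n.+1.-tuple T)) : \bar R :=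
  (@lebesgue_measure R \x mu) (tcons @^-1` A).

Let mpre A : measurable A -> measurable (tcons @^-1` A).
Proof. by move=> mA; rewrite -[X in measurable X]setTI; exact: measurable_tcons. Qed.

Let leb_cons0 : leb_cons set0 = 0.
Proof. by rewrite /leb_cons preimage_set0 measure0. Qed.

Let leb_cons_ge0 A : 0 <= leb_cons A.
Proof. exact: measure_ge0. Qed.

Let leb_cons_sigma_additive : semi_sigma_additive leb_cons.
Proof.
move=> F mF tF mUF; rewrite /leb_cons preimage_bigcup.
apply: measure_semi_sigma_additive.
- by move=> i; exact: mpre.
- apply/trivIsetP => /= i j _ _ ij; rewrite -preimage_setI.
  by move/trivIsetP : tF => /(_ _ _ _ _ ij) ->//; rewrite preimage_set0.
- by rewrite -preimage_bigcup; exact: mpre.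
Qed.

HB.instance Definition _ := isMeasure.Build _ _ _ leb_cons
  leb_cons0 leb_cons_ge0 leb_cons_sigma_additive.

Let leb_cons_sigma_finite : sigma_finite setT leb_cons.
Proof.
have /sigma_finiteP[F [TF ndF Foo]] := sigma_finiteT (@lebesgue_measure R).
have /sigma_finiteP[G [TG ndG Goo]] := sigma_finiteT mu.
exists (fun i => tuncons @^-1` (F i `*` G i)) => [|i].
  apply/esym; rewrite -subTset => t _.
  have [j _ Fjx] : (\bigcup_i F i) (tuncons t).1 by rewrite -TF.
  have [k _ Gky] : (\bigcup_i G i) (tuncons t).2 by rewrite -TG.
  exists (maxn j k) => //; split.
  - by move: (tuncons t).1 Fjx; exact/subsetPset/ndF/leq_maxl.
  - by move: (tuncons t).2 Gky; exact/subsetPset/ndG/leq_maxr.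
have [mFi Fioo] := Foo i; have [mGi Gioo] := Goo i.
have mFG : measurable (F i `*` G i) by exact: measurableX.
split; first by rewrite -[X in measurable X]setTI; exact: measurable_tuncons.
rewrite /leb_cons (_ : _ @^-1` _ = F i `*` G i).
  by rewrite product_measure1E// lte_mul_pinfty// ge0_fin_numE.
rewrite -comp_preimage (_ : _ \o _ = idfun)//; apply/funext => p.
exact: tconsK.
Qed.

HB.instance Definition _ := Measure_isSigmaFinite.Build _ _ _ leb_cons
  leb_cons_sigma_finite.

End lebesgue_tuple_step.

Fixpoint leb (R : realType) (n : nat) :
    {sigma_finite_measure set (n.-tuple (measurableTypeR R)) -> \bar R} :=
  match n with
  | 0%N => \d_[tuple]
  | n'.+1 => leb_cons (leb R n')
  end.

Section euclidean.
Context (R : realType) (d : nat).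
Implicit Types (x y : 'rV[R]_d) (A : set 'rV[R]_d) (g : 'rV[R]_d -> R).

Definition dotv x y : R := \sum_i x 0 i * y 0 i.

(* The norm `|x| of MathComp-Analysis on 'rV[R]_d is the sup norm. *)
Definition enorm x : R := Num.sqrt (dotv x x).

Definition eball x (r : R) : set 'rV[R]_d := [set y | enorm (y - x) < r].

Definition diam A : R := sup [set enorm (p.1 - p.2) | p in A `*` A].

Definition inscribed_diam A : R :=
  sup [set 2 * r | r in [set r | 0 <= r /\ exists c, eball c r `<=` A]].

Definition pt (t : d.-tuple (measurableTypeR R)) : 'rV[R]_d :=
  \row_i tnth t i.

Definition integral_on A g : R :=
  (\int[leb R d]_(t in pt @^-1` A) g (pt t))%R.

Definition L2_on A g : Prop := (g \_ A) \o pt \in Lfun (leb R d) 2%:E.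

(* Near each boundary point, A lies strictly below the graph, in some direction
   e, of a Lipschitz function of the component orthogonal to e. *)
Definition lipschitz_boundary A : Prop :=
  forall x, closure A x -> ~ interior A x ->
  exists r : R, exists L : R, exists e : 'rV[R]_d, exists gam : 'rV[R]_d -> R,
  [/\ 0 < r, enorm e = 1,
      forall y z, `|gam y - gam z| <= L * enorm (y - z)
    & forall y, eball x r y -> A y <-> dotv y e < gam (y - dotv y e *: e)].

Definition ref_simplex : set 'rV[R]_d :=
  [set t | (forall i, 0 <= t 0 i) /\ \sum_i t 0 i <= 1].

End euclidean.

(* A finite set of simplices of R^d with indexed vertices. A simplex is given by
   the set of (the indices of) its vertices. *)
Record mesh (R : realType) (d : nat) := Mesh {
  nvtx : nat;
  vtx : 'I_nvtx -> 'rV[R]_d;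
  cells : {set {set 'I_nvtx}} }.

Section mesh.
Context (R : realType) (d : nat) (M : mesh R d).
Implicit Types (K E S : {set 'I_(nvtx M)}) (Om : set 'rV[R]_d).

Definition hull S : set 'rV[R]_d :=
  [set x | exists a : 'I_(nvtx M) -> R,
    [/\ forall i, 0 <= a i, \sum_(i in S) a i = 1
      & x = \sum_(i in S) a i *: vtx i]].

Definition affinely_independent S : Prop :=
  forall a : 'I_(nvtx M) -> R, \sum_(i in S) a i = 0 ->
  \sum_(i in S) a i *: vtx i = 0 -> forall i, i \in S -> a i = 0.

Definition simplicial : Prop :=
  forall K, K \in cells M -> #|K| = d.+1 /\ affinely_independent K.

Definition covers Om : Prop :=
  closure Om = \bigcup_(K in [set K | K \in cells M]) hull K.

Definition conforming : Prop :=
  forall K K', K \in cells M -> K' \in cells M ->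
  hull K `&` hull K' = hull (K :&: K').

Definition triangulation Om : Prop :=
  [/\ simplicial, conforming & covers Om].

Definition hK K : R := diam (hull K).

Definition mesh_size : R := \big[Num.max/0]_(K in cells M) hK K.

Definition shape_regular (sigma : R) : Prop :=
  forall K, K \in cells M -> hK K <= sigma * inscribed_diam (hull K).

Definition quasi_uniform (tau : R) : Prop :=
  forall K, K \in cells M -> mesh_size <= tau * hK K.

Definition faces_of K : {set {set 'I_(nvtx M)}} :=
  [set E : {set 'I_(nvtx M)} | (E \subset K) && (#|E| == d)].

Definition faces : {set {set 'I_(nvtx M)}} :=
  \bigcup_(K in cells M) faces_of K.

Definition outward_normal K E (n : 'rV[R]_d) : Prop :=
  [/\ enorm n = 1,
      forall i j, i \in E -> j \in E -> dotv n (vtx i - vtx j) = 0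
    & forall i j, i \in K :\: E -> j \in E -> dotv n (vtx i - vtx j) < 0].

Definition unit_normal K E : 'rV[R]_d := xget 0 [set n | outward_normal K E n].

Definition cell_int K (g : 'rV[R]_d -> R) : R := integral_on (hull K) g.

(* Surface integral over the (d-1)-simplex E: its affine parametrization
   by the reference simplex of R^(d-1) has the constant area element
   sqrt (det (J J^T)), J being the matrix of its edge vectors. *)
Definition face_pts E : seq 'rV[R]_d := [seq vtx i | i <- enum E].

Definition face_edges E : 'M[R]_(d.-1, d) :=
  \matrix_(i, j) (nth 0 (face_pts E) i.+1 - nth 0 (face_pts E) 0) 0 j.

Definition face_param E (t : 'rV[R]_d.-1) : 'rV[R]_d :=
  nth 0 (face_pts E) 0 + t *m face_edges E.

Definition face_int E (g : 'rV[R]_d -> R) : R :=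
  Num.sqrt (\det (face_edges E *m (face_edges E)^T))
  * integral_on (@ref_simplex R d.-1) (g \o face_param E).

End mesh.

(* The notations of mpoly clash with those of MathComp-Analysis, and its
   canonical structures with the above HB.instance commands. *)
Import -(notations) mpoly.

Section discrete_spaces.
Context (R : realType) (d : nat) (M : mesh R d).
Local Notation simplex := {set 'I_(nvtx M)}.

Definition peval (p : mpoly d R) (x : 'rV[R]_d) : R := meval (fun i => x 0 i) p.

Definition deg_le (k : nat) (p : mpoly d R) : Prop :=
  (mmeasure mdeg p <= k.+1)%N.

(* A piecewise polynomial is given by its polynomial on each cell (or face),
   so that it has a trace from each cell and elementwise derivatives; only the
   values at cells (resp. faces) of the mesh are relevant. As an element of L^2
   it is determined by the values of each polynomial on the simplex. *)
Definition pw := simplex -> mpoly d R.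
Definition pwv := simplex -> 'I_d -> mpoly d R.

Definition in_V (k : nat) (v : pwv) : Prop :=
  forall K, K \in cells M -> forall i, deg_le k (v K i).

Definition in_W (k : nat) (w : pw) : Prop :=
  forall K, K \in cells M -> deg_le k.+1 (w K).

Definition in_M (k : nat) (m : pw) : Prop :=
  forall E, E \in faces M -> deg_le k (m E).

Definition vol (F : simplex -> 'rV[R]_d -> R) : R :=
  \sum_(K in cells M) cell_int K (F K).

Definition bdr (F : simplex -> simplex -> 'rV[R]_d -> R) : R :=
  \sum_(K in cells M) \sum_(E in faces_of K) face_int E (F K E).

Definition divergence (v : 'I_d -> mpoly d R) : mpoly d R := \sum_i mderiv i (v i).

Definition vdot (v : 'I_d -> mpoly d R) (n x : 'rV[R]_d) : R :=
  \sum_i peval (v i) x * n 0 i.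

(* The projection is unique as a function on E, not as a polynomial on R^d; it
   is only ever evaluated on E. *)
Definition is_face_proj (k : nat) (E : simplex) (g : 'rV[R]_d -> R)
    (p : mpoly d R) : Prop :=
  deg_le k p /\ forall m, deg_le k m ->
    face_int E (fun x => (peval p x - g x) * peval m x) = 0.

Definition face_proj k E (p : mpoly d R) : 'rV[R]_d -> R :=
  peval (xget 0 [set s | is_face_proj k E (peval p) s]).

Definition opA (k : nat) (q : pwv) (u uh : pw) (r : pwv) (w m : pw) : R :=
  vol (fun K x => \sum_i peval (q K i) x * peval (r K i) x)
  - vol (fun K x => peval (u K) x * peval (divergence (r K)) x)
  + bdr (fun K E x => peval (uh E) x * vdot (r K) (unit_normal K E) x)
  + vol (fun K x => peval (divergence (q K)) x * peval (w K) x)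
  - bdr (fun K E x => vdot (q K) (unit_normal K E) x * peval (m E) x)
  + bdr (fun K E x => (hK K)^-1 * (face_proj k E (u K) x - peval (uh E) x)
                                * (face_proj k E (w K) x - peval (m E) x)).

Record state := State {
  sp : pwv; sphi : pw; sphih : pw; sq : pwv; su : pw; suh : pw }.

Definition in_spaces (k : nat) (s : state) : Prop :=
  [/\ in_V k (sp s), in_W k (sphi s) & in_M k (sphih s)] /\
  [/\ in_V k (sq s), in_W k (su s) & in_M k (suh s)].

Definition same_state (s s' : state) : Prop :=
  (forall K, K \in cells M -> forall x, hull K x ->
    [/\ forall i, peval (sp s K i) x = peval (sp s' K i) x,
        peval (sphi s K) x = peval (sphi s' K) x,
        forall i, peval (sq s K i) x = peval (sq s' K i) x
      & peval (su s K) x = peval (su s' K) x]) /\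
  (forall E, E \in faces M -> forall x, hull E x ->
    peval (sphih s E) x = peval (sphih s' E) x /\
    peval (suh s E) x = peval (suh s' E) x).

Definition is_W_proj (Om : set 'rV[R]_d) (k : nat) (u0 : 'rV[R]_d -> R)
    (w0 : pw) : Prop :=
  in_W k w0 /\ forall w, in_W k w ->
    vol (fun K x => peval (w0 K) x * peval (w K) x) =
    vol (fun K x => (u0 \_ Om) x * peval (w K) x).

(* Of the state of index 0, only u_h^0 is used. In f a b, the value of u_h^n is
   a and that of u_h^{n-1} is b. *)
Definition hdg_solution (Om : set 'rV[R]_d) (k : nat) (f : R -> R -> R)
    (eps T : R) (N : nat) (u0 : 'rV[R]_d -> R) (s : nat -> state) : Prop :=
  let dt := T / N%:R in
  is_W_proj Om k u0 (su (s 0%N)) /\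
  forall n, (0 < n <= N)%N ->
    in_spaces k (s n) /\
    forall (r1 : pwv) (w1 m1 : pw) (r2 : pwv) (w2 m2 : pw),
    in_V k r1 -> in_W k w1 -> in_M k m1 ->
    in_V k r2 -> in_W k w2 -> in_M k m2 ->
    vol (fun K x =>
           (peval (su (s n) K) x - peval (su (s n.-1) K) x) / dt
           * peval (w1 K) x)
      + opA k (sp (s n)) (sphi (s n)) (sphih (s n)) r1 w1 m1 = 0 /\
    vol (fun K x =>
           eps^-1 * f (peval (su (s n) K) x) (peval (su (s n.-1) K) x)
           * peval (w2 K) x)
      + eps * opA k (sq (s n)) (su (s n)) (suh (s n)) r2 w2 m2
      - vol (fun K x => peval (sphi (s n) K) x * peval (w2 K) x) = 0.

Definition hdg_unique (Om : set 'rV[R]_d) (k : nat) (f : R -> R -> R)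
    (eps T : R) (N : nat) (u0 : 'rV[R]_d -> R) : Prop :=
  forall s s' : nat -> state,
  hdg_solution Om k f eps T N u0 s -> hdg_solution Om k f eps T N u0 s' ->
  forall n, (0 < n <= N)%N -> same_state (s n) (s' n).

End discrete_spaces.

Definition polyhedral (R : realType) (d : nat) (Om : set 'rV[R]_d) : Prop :=
  exists P : mesh R d, simplicial P /\ covers P Om.

Definition polyhedral_lipschitz_domain (R : realType) (d : nat)
    (Om : set 'rV[R]_d) : Prop :=
  [/\ [/\ Om !=set0, open Om & connected Om],
      exists B : R, forall x, Om x -> enorm x <= B,
      polyhedral Om & lipschitz_boundary Om].

Definition f_convex_splitting (R : realType) (a b : R) : R := a ^+ 3 - b.
Definition f_backward_euler (R : realType) (a b : R) : R := a ^+ 3 - a.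

(* Main.v *)
Require Import Defs.
From mathcomp Require Import all_boot all_order all_algebra.
From mathcomp Require Import all_classical all_reals all_analysis.
From mathcomp Require Import measurable_realfun ring lra.
From mathcomp Require mpoly.

(** Two solutions agree at every step by induction on the step: if they have
    the same values of u_h^{n-1}, the differences (p, phi, phih), (q, u, uh) of
    their unknowns at step n solve the homogeneous scheme in which f is
    replaced by (u1^3 - u2^3) - l u, with l = 0 for the convex splitting and
    l = 1 for backward Euler (lemma step_unique). Let S be the bilinear form of
    the stabilization term, and
      P = |p|^2 + S(phi, phi),  Q = |q|^2 + S(u, u),  X = (q, p) + S(phi, u),
    where S(phi, u) is short for S((phi, phih), (u, uh)), and so on. Then
      (1)  (u, phi) / dt + P = 0,
      (2)  ((u1^3 - u2^3, u) - l |u|^2) / eps + eps Q - (phi, u) = 0,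
      (3)  |u|^2 / dt + X = 0.
    The first two are the usual energy identities: the first equation is tested
    with (p, phi, phih) and the second one with (q, u, uh). For (3), the first
    equation is tested with (0, u, uh), and the two flux terms that appear are
    removed by testing the second equation with (p, 0, 0).

    Identity (3) replaces |u|^2, the only term of the wrong sign, by dt times a
    product of the dissipated quantities, which (1) and (2) control; neither a
    Poincare nor an inverse inequality is used, so no constant depends on the
    mesh. By the Cauchy-Schwarz inequality, in the form
    0 <= eps^2 P + 2 eps l X + l^2 Q, the three identities give
      2 eps (u1^3 - u2^3, u) + eps^3 Q + eps^2 dt P <= 0
    as soon as l^2 dt <= eps^3 (lemma energy_estimate), which always holds if
    l = 0, and holds with C = 1 if l = 1. Since the cube is strictly increasing,
    u = 0; also p = q = 0. Exchanging the roles of the two equations in (3)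
    gives phi = 0, and then the vanishing of the stabilization gives uh = 0 and
    phih = 0, as these are the face projections of u = 0 and phi = 0.

    For this computation the integrals over cells and faces must act as scalar
    products on piecewise polynomials. They are linear because polynomials are
    bounded and measurable on simplices. They are definite because near each
    point of a simplex there is a box inside the simplex, so that a continuous
    nonnegative function of zero integral vanishes on the simplex (lemma
    integral_on_eq0); faces are reduced to this case by their parametrization,
    whose area element is positive as a Gram determinant of independent edges
    (lemma gram_det_gt0). The projections on faces exist by the Gram-Schmidt
    process (lemma orthogonal_projection), and are then linear. *)

Set Implicit Arguments.
Unset Strict Implicit.
Unset Printing Implicit Defensive.
Import Order.TTheory GRing.Theory Num.Theory.
Import numFieldNormedType.Exports.
Local Open Scope classical_set_scope.
Local Open Scope ring_scope.

Import -(notations) mpoly.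

(** * Polynomial functions *)

Section polynomial_functions.
Context (R : realType).

(** An inductive description of polynomial functions rather than the existence
    of a formal polynomial: continuity, measurability, boundedness and
    composition then follow by four-case inductions. *)
Inductive polyfun (n : nat) : ('rV[R]_n -> R) -> Prop :=
| polyfun_cst c : polyfun (fun=> c)
| polyfun_coord i : polyfun (fun x => x 0 i)
| polyfunD f g : polyfun f -> polyfun g -> polyfun (fun x => f x + g x)
| polyfunM f g : polyfun f -> polyfun g -> polyfun (fun x => f x * g x).

Lemma polyfunN n (f : 'rV[R]_n -> R) :
  polyfun f -> polyfun (fun x => - f x).
Proof.
move=> pf; rewrite (_ : (fun _ => _) = (fun x => -1 * f x)).
  exact: polyfunM (polyfun_cst _ _) pf.
by apply/funext => x; rewrite mulN1r.
Qed.

Lemma polyfunB n (f g : 'rV[R]_n -> R) :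
  polyfun f -> polyfun g -> polyfun (fun x => f x - g x).
Proof. by move=> pf pg; apply: polyfunD => //; exact: polyfunN. Qed.

Lemma polyfunX n (f : 'rV[R]_n -> R) k :
  polyfun f -> polyfun (fun x => f x ^+ k).
Proof.
move=> pf; elim: k => [|k IH]; first exact: (polyfun_cst _ 1).
rewrite (_ : (fun _ => _) = (fun x => f x * f x ^+ k)); first exact: polyfunM.
by apply/funext => x; rewrite exprS.
Qed.

Lemma polyfun_sum n (I : Type) (r : seq I) (P : pred I)
    (F : I -> 'rV[R]_n -> R) :
  (forall i, polyfun (F i)) -> polyfun (fun x => \sum_(i <- r | P i) F i x).
Proof.
move=> pF; elim: r => [|i r IH].
  rewrite (_ : (fun _ => _) = (fun=> 0)); first exact: polyfun_cst.
  by apply/funext => x; rewrite big_nil.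
rewrite (_ : (fun _ => _) =
  (fun x => (if P i then F i x else 0) + \sum_(j <- r | P j) F j x)).
  apply: polyfunD => //; case: (P i) => //; exact: polyfun_cst.
by apply/funext => x; rewrite big_cons; case: ifP; rewrite ?add0r.
Qed.

Lemma polyfun_prod n (I : Type) (r : seq I) (F : I -> 'rV[R]_n -> R) :
  (forall i, polyfun (F i)) -> polyfun (fun x => \prod_(i <- r) F i x).
Proof.
move=> pF; elim: r => [|i r IH].
  rewrite (_ : (fun _ => _) = (fun=> 1)); first exact: polyfun_cst.
  by apply/funext => x; rewrite big_nil.
rewrite (_ : (fun _ => _) = (fun x => F i x * \prod_(j <- r) F j x)).
  exact: polyfunM.
by apply/funext => x; rewrite big_cons.
Qed.

Lemma polyfun_peval n (p : mpoly n R) : polyfun (peval p).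
Proof.
rewrite (_ : peval p =
  fun x => \sum_(m <- msupp p) mcoeff m p * \prod_i x 0 i ^+ fun_of_multinom m i).
  apply: polyfun_sum => m; apply: polyfunM; first exact: polyfun_cst.
  by apply: polyfun_prod => i; apply: polyfunX; exact: polyfun_coord.
by apply/funext => x; rewrite /peval mevalE.
Qed.

Lemma polyfun_comp m n (f : 'rV[R]_n -> R) (phi : 'rV[R]_m -> 'rV[R]_n) :
  polyfun f -> (forall i, polyfun (fun t => phi t 0 i)) ->
  polyfun (f \o phi).
Proof.
move=> pf pphi; elim: pf => [c|i|g h _ Ig _ Ih|g h _ Ig _ Ih] //.
- exact: polyfun_cst.
- exact: pphi.
- exact: polyfunD Ig Ih.
- exact: polyfunM Ig Ih.
Qed.

Lemma polyfun_continuous n (f : 'rV[R]_n -> R) : polyfun f -> continuous f.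
Proof.
elim=> [c|i|g h _ Ig _ Ih|g h _ Ig _ Ih] x.
- exact: cst_continuous.
- exact: coord_continuous.
- exact: (cvgD (Ig x) (Ih x)).
- exact: (cvgM (Ig x) (Ih x)).
Qed.

Lemma polyfun_measurable n (f : 'rV[R]_n -> R) :
  polyfun f -> measurable_fun setT (f \o @pt R n).
Proof.
elim=> [c|i|g h _ Ig _ Ih|g h _ Ig _ Ih].
- exact: measurable_cst.
- rewrite (_ : _ \o _ = (@tnth _ _)^~ i); first exact: measurable_tnth.
  by apply/funext => t /=; rewrite mxE.
- exact: measurable_funD.
- exact: measurable_funM.
Qed.

Definition box n (c : 'rV[R]_n) (r : R) : set 'rV[R]_n :=
  [set x | forall i, `|x 0 i - c 0 i| <= r].

Lemma polyfun_bounded n (f : 'rV[R]_n -> R) B : polyfun f ->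
  exists C, forall x, box 0 B x -> `|f x| <= C.
Proof.
elim=> [c|i|g h _ [C Cg] _ [D Dh]|g h _ [C Cg] _ [D Dh]].
- by exists `|c|.
- by exists B => x /(_ i); rewrite mxE subr0.
- exists (C + D) => x xB; apply: (le_trans (ler_normD _ _)).
  by apply: lerD; [exact: Cg|exact: Dh].
- by exists (C * D) => x xB; rewrite normrM ler_pM //; [exact: Cg|exact: Dh].
Qed.

Lemma box_nbhs n (x : 'rV[R]_n) (A : set 'rV[R]_n) :
  nbhs x A -> exists2 r : R, 0 < r & box x r `<=` A.
Proof.
move=> /nbhs_ballP[e /= e0 xA]; exists (e / 2); first by rewrite divr_gt0.
move=> y yx; apply: xA => //; split=> // i j; rewrite ord1 /ball/= /ball_ distrC.
by apply: le_lt_trans (yx j) _; rewrite ltr_pdivrMr // ltr_pMr // ltr1n.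
Qed.

(** The form in which continuity enters the definiteness of the integral: a
    strict lower bound persists on a box. *)
Lemma polyfun_near n (f : 'rV[R]_n -> R) x c : polyfun f -> c < f x ->
  exists2 r : R, 0 < r & forall y, box x r y -> c < f y.
Proof.
move=> /polyfun_continuous cf cfx.
apply: (@box_nbhs _ _ [set y | c < f y]).
exact: (cf x _ (lt_nbhsr cfx)).
Qed.

End polynomial_functions.

(** * Integration of polynomials over fat bounded sets *)

Section boxes.
Context (R : realType).

Lemma measurable_box n (c : 'rV[R]_n) r :
  measurable (@pt R n @^-1` box c r).
Proof.
rewrite (_ : _ @^-1` _ = \bigcap_(i in [set: 'I_n])
   (fun t : n.-tuple (measurableTypeR R) => tnth t i) @^-1` `[c 0 i - r, c 0 i + r]).
  apply: fin_bigcap_measurable; first exact: finite_finset.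
  by move=> i _; rewrite -[X in measurable X]setTI; exact: measurable_tnth.
apply/seteqP; split => t /= tc i.
  by move=> _; have := tc i; rewrite /= mxE ler_distl in_itv.
by have := tc i I; rewrite mxE ler_distl /= in_itv.
Qed.

(** By induction on the dimension, as the measure is a product along the first
    coordinate. Finiteness of these values makes bounded sets of finite measure,
    and positivity makes boxes non-negligible. *)
Lemma leb_box n (c : 'rV[R]_n) r : 0 <= r ->
  leb R n (@pt R n @^-1` box c r) = ((2 * r) ^+ n)%:E.
Proof.
move=> r0; elim: n c => [|n IH] c.
  by rewrite /= diracE mem_set ?expr0 // => -[].
rewrite /= /leb_cons.
pose c' : 'rV[R]_n := \row_i c 0 (lift ord0 i).
rewrite (_ : _ @^-1` _ = `[c 0 ord0 - r, c 0 ord0 + r] `*` (@pt R n @^-1` box c' r)).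
  rewrite product_measure1E//=; last exact: measurable_box.
  rewrite IH exprS EFinM; congr *%E.
  rewrite lebesgue_measure_itv /= lte_fin; case: ltP => h; last first.
    have -> : r = 0 by apply/eqP; rewrite eq_le r0 andbT; lra.
    by rewrite mulr0.
  by rewrite -EFinD; congr EFin; ring.
apply/seteqP; split=> -[x t] /=.
  move=> xt; split.
    have := xt ord0; rewrite /= mxE ler_distl (tnth_nth 0) /=.
    by rewrite in_itv.
  move=> i; have := xt (lift ord0 i); rewrite /= !mxE !(tnth_nth 0) /=.
  by [].
move=> [xc tc] i; case: (unliftP ord0 i) => [j|] ->; rewrite !mxE (tnth_nth 0) /=.
  have := tc j; rewrite /= !mxE (tnth_nth 0) /=; by [].
by move: xc; rewrite in_itv /= ler_distl.
Qed.

End boxes.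

Section bodies.
Context (R : realType) (n : nat).
Implicit Types (A : set 'rV[R]_n) (f g : 'rV[R]_n -> R).

(** The properties of simplices that integration of polynomials relies on. The
    third one, every point of A is a limit of nondegenerate boxes inside A, says
    that A is contained in the closure of its interior. *)
Definition body A : Prop :=
  [/\ measurable (@pt R n @^-1` A), exists B, A `<=` box 0 B &
      forall x r, A x -> 0 < r ->
        exists c, exists2 s : R, 0 < s & box c s `<=` A `&` box x r].

Variable A : set 'rV[R]_n.
Hypothesis bA : body A.

Lemma polyfun_integrable f : polyfun f ->
  (leb R n).-integrable (@pt R n @^-1` A) (EFin \o (f \o @pt R n)).
Proof.
case: bA => mA [B AB] _ pf; apply: measurable_bounded_integrable => //.
- apply: (@le_lt_trans _ _ (leb R n (@pt R n @^-1` box 0 `|B|))).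
    apply: le_measure; rewrite ?inE //; first exact: measurable_box.
    move=> t /AB tB i; exact: le_trans (tB i) (ler_norm _).
  by rewrite leb_box // ltry.
- by apply: (@measurable_funTS _ _ _ _ _ (f \o @pt R n)); exact: polyfun_measurable.
- have [C fC] := polyfun_bounded B pf.
  exists C; split; first by rewrite num_real.
  move=> M CM t /= At; exact: le_trans (fC _ (AB _ At)) (ltW CM).
Qed.

Lemma integral_onP (a : R) f g : polyfun f -> polyfun g ->
  integral_on A (fun x => a * f x + g x) =
  a * integral_on A f + integral_on A g.
Proof.
have [mA _ _] := bA => pf pg; rewrite /integral_on.
rewrite (@RintegralD _ _ _ _ _ (fun t => a * f (pt t)) (g \o @pt R n)) //.
- rewrite (@RintegralZl _ _ _ _ _ (f \o @pt R n)) //.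
  exact: polyfun_integrable.
- apply: (@polyfun_integrable (fun x => a * f x)).
  by apply: polyfunM => //; exact: polyfun_cst.
- exact: polyfun_integrable.
Qed.

Lemma integral_on_ge0 f : (forall x, A x -> 0 <= f x) -> 0 <= integral_on A f.
Proof. by move=> f0; apply: Rintegral_ge0 => t At; exact: f0. Qed.

Lemma eq_integral_on f g : (forall x, A x -> f x = g x) ->
  integral_on A f = integral_on A g.
Proof.
move=> fg; rewrite /integral_on; apply: eq_Rintegral => t.
by rewrite inE => At; exact: fg.
Qed.

(** If f is positive at x, it is bounded below by f x / 2 near x, hence on a box
    inside A, which has positive measure. *)
Lemma integral_on_eq0 f : polyfun f -> (forall x, A x -> 0 <= f x) ->
  integral_on A f = 0 -> forall x, A x -> f x = 0.
Proof.
have [mA _ fatA] := bA => pf f0 If0 x Ax; apply/eqP; rewrite eq_le f0 // andbT.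
rewrite leNgt; apply/negP => fx.
have fx2 : f x / 2 < f x by rewrite ltr_pdivrMr // ltr_pMr // ltr1n.
have [r r0 fr] := polyfun_near pf fx2.
have [c [s s0 csA]] := fatA _ _ Ax r0.
have fin := integrable_fin_num mA (polyfun_integrable pf).
have Ie0 : (\int[leb R n]_(t in @pt R n @^-1` A) (f (pt t))%:E = 0)%E.
  by rewrite -[LHS](fineK fin) -[X in X%:E = _]/(integral_on A f) If0.
have mf : measurable_fun setT (EFin \o (f \o @pt R n)).
  by apply/measurable_EFinP; exact: polyfun_measurable.
have : (0 < \int[leb R n]_(t in @pt R n @^-1` box c s) (f x / 2)%:E)%E.
  rewrite integral_cst; last exact: measurable_box.
  rewrite [X in (_ * X)%E](leb_box c (ltW s0)).
  by rewrite -EFinM lte_fin mulr_gt0 ?exprn_gt0 ?mulr_gt0 // divr_gt0.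
apply/negP; rewrite -leNgt -Ie0.
apply: (@le_trans _ _
  (\int[leb R n]_(t in @pt R n @^-1` box c s) (f (pt t))%:E)%E).
  apply: ge0_le_integral => //.
  - exact: measurable_box.
  - by move=> t _; rewrite lee_fin divr_ge0 // ltW.
  - exact: measurable_funTS mf.
  - by move=> t /csA[_ /fr/ltW]; rewrite lee_fin.
apply: ge0_subset_integral => //.
- exact: measurable_box.
- exact: measurable_funTS mf.
- by move=> t /f0.
- by move=> t /csA[].
Qed.

End bodies.

(** * Polytopes and the reference simplex *)

Section polytopes.
Context (R : realType) (n : nat).

(** Affinity is expressed along segments: a polytope is explored by moving
    from one of its points towards an interior one. *)
Definition affine (l : 'rV[R]_n -> R) : Prop :=
  polyfun l /\ forall x y t, l (x + t *: (y - x)) = l x + t * (l y - l x).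

(** A point x of the polytope is approached by points y on the segment from x to
    the interior point c. All constraints are strict at y, so they hold on a box
    around y. *)
Lemma polytope_body (J : finType) (l : J -> 'rV[R]_n -> R) c B :
  let A := [set x | forall j, 0 <= l j x] in
  (forall j, affine (l j)) -> A `<=` box 0 B -> (forall j, 0 < l j c) ->
  body A.
Proof.
move=> A affl AB lc; split; [|by exists B|].
  rewrite (_ : _ @^-1` _ = \bigcap_(j in [set: J])
     (l j \o @pt R n) @^-1` `[0, +oo[).
    apply: fin_bigcap_measurable; first exact: finite_finset.
    move=> j _; rewrite -[X in measurable X]setTI.
    by apply: polyfun_measurable => //; case: (affl j).
  apply/seteqP; split => t /= tA j; first by move=> _; rewrite /= in_itv /= andbT tA.
  by have := tA j I; rewrite /= in_itv /= andbT.
move=> x r Ax r0.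
have Ac : A c by move=> j; exact: ltW.
(* D bounds the displacement |c - x| componentwise; the term r makes D positive
   and t at most 1. *)
pose D := 2 * `|B| + r.
have D0 : 0 < D by rewrite ltr_wpDl // mulr_ge0.
pose t := r / 2 / D.
have t0 : 0 < t by rewrite !divr_gt0.
have t1 : t <= 1.
  rewrite ler_pdivrMr // mul1r /D; have := normr_ge0 B; lra.
pose y := x + t *: (c - x).
have ly j : 0 < l j y.
  have [_ ->] := affl j.
  have -> : l j x + t * (l j c - l j x) = (1 - t) * l j x + t * l j c by ring.
  apply: ltr_wpDl; last by rewrite mulr_gt0 // lc.
  by rewrite mulr_ge0 ?subr_ge0 // Ax.
have : nbhs y [set z | forall j, 0 < l j z].
  have := @filter_forall _ _ (fun j => [set z | 0 < l j z]) (nbhs y) _.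
  apply => j.
  have cl := polyfun_continuous (affl j).1 (x := y).
  exact: (cl _ (lt_nbhsr (ly j))).
move=> /box_nbhs[s s0 ys].
exists y, (Num.min s (r / 2)); first by rewrite lt_min s0 divr_gt0.
move=> z zy; split.
  move=> j; apply/ltW/ys => i; apply: (le_trans (zy i)).
  by rewrite ge_min lexx.
move=> i; rewrite -(subrK (y 0 i) (z 0 i)) -addrA.
have -> : r = r / 2 + r / 2 by lra.
apply: (le_trans (ler_normD _ _)); apply: lerD.
  by apply: (le_trans (zy i)); rewrite ge_min lexx orbT.
rewrite /y !mxE addrAC subrr add0r normrM (ger0_norm (ltW t0)) /t.
rewrite mulrAC ler_pdivrMr // ler_pM2l ?divr_gt0 //.
have h (u : 'rV[R]_n) : A u -> `|u 0 i| <= `|B|.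
  by move=> /AB/(_ i); rewrite mxE subr0 => /le_trans; apply; exact: ler_norm.
apply: (le_trans (ler_normB _ _)); have := h _ Ac; have := h _ Ax.
rewrite /D; lra.
Qed.

(** Barycentric coordinates with respect to the vertices of the reference
    simplex; None stands for the vertex at the origin. *)
Definition ref_coord (j : option 'I_n) (t : 'rV[R]_n) : R :=
  if j is Some i then t 0 i else 1 - \sum_i t 0 i.

Lemma ref_simplexE : @ref_simplex R n = [set t | forall j, 0 <= ref_coord j t].
Proof.
apply/seteqP; split=> t /=; last first.
  by move=> ht; split=> [i|]; [exact: (ht (Some i))|have := ht None; rewrite /= subr_ge0].
by move=> [t0 t1] [i|] //=; rewrite subr_ge0.
Qed.

Lemma affine_ref_coord j : affine (ref_coord j).
Proof.
case: j => [i|]; split.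
- exact: polyfun_coord.
- by move=> x y t; rewrite /= !mxE.
- apply: polyfunB; first exact: polyfun_cst.
  by apply: polyfun_sum => i; exact: polyfun_coord.
- move=> x y t /=.
  have -> : \sum_i (x + t *: (y - x)) 0 i =
      \sum_i x 0 i + t * (\sum_i y 0 i - \sum_i x 0 i).
    rewrite -sumrB mulr_sumr -big_split; apply: eq_bigr => i _.
    by rewrite !mxE.
  ring.
Qed.

Definition ref_center : 'rV[R]_n := const_mx n.+1%:R^-1.

Lemma ref_coord_center j : 0 < ref_coord j ref_center.
Proof.
case: j => [i|] /=; first by rewrite mxE invr_gt0 ltr0n.
under eq_bigr do rewrite mxE.
rewrite sumr_const card_ord -[X in 1 - X]mulr_natl subr_gt0 ltr_pdivrMr ?ltr0n // mul1r.
by rewrite ltr_nat.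
Qed.

Lemma body_ref_simplex : body (@ref_simplex R n).
Proof.
rewrite ref_simplexE; apply: (@polytope_body _ _ ref_center 1).
- exact: affine_ref_coord.
- rewrite -ref_simplexE => t [t0 t1] i; rewrite mxE subr0 ger0_norm //.
  by apply: le_trans t1; rewrite (bigD1 i) //= lerDl sumr_ge0.
- exact: ref_coord_center.
Qed.

(** The box contained in A provides two distinct points; boundedness of A makes
    the supremum defining the diameter meaningful. *)
Lemma body_diam_gt0 (A : set 'rV[R]_n) :
  (0 < n)%N -> body A -> A !=set0 -> 0 < diam A.
Proof.
move=> n0 [_ [B AB] fatA] [x Ax].
have [c [s s0 cA]] := fatA _ _ Ax ltr01.
pose i0 : 'I_n := Ordinal n0.
pose c' := c + s *: delta_mx 0 i0.
have Ac : A c by apply: (cA _ _).1 => i; rewrite subrr normr0 ltW.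
have Ac' : A c'.
  apply: (cA _ _).1 => i; rewrite /c' !mxE addrAC subrr add0r eqxx /=.
  by case: eqP => _; rewrite ?mulr1 ?mulr0 ?normr0 ?gtr0_norm // ltW.
apply: (@lt_le_trans _ _ (enorm (c' - c))).
  rewrite sqrtr_gt0 /dotv (bigD1 i0) //= ltr_wpDr //.
    by apply: sumr_ge0 => i _; rewrite -expr2 sqr_ge0.
  rewrite /c' addrAC subrr add0r !mxE !eqxx mulr1; exact: mulr_gt0.
apply: ub_le_sup; last by exists (c', c).
exists (Num.sqrt (\sum_(i < n) (2 * `|B|) ^+ 2)) => _ [[y z] [/= Ay Az] <-].
apply: ler_wsqrtr; apply: ler_sum => i _; rewrite -expr2 -real_normK ?num_real //.
rewrite lerXn2r ?nnegrE ?mulr_ge0 // !mxE.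
have h (u : 'rV[R]_n) : A u -> `|u 0 i| <= `|B|.
  by move=> /AB/(_ i); rewrite mxE subr0 => /le_trans; apply; exact: ler_norm.
apply: (le_trans (ler_normB _ _)); have := h _ Ay; have := h _ Az; lra.
Qed.

End polytopes.

(** * Gram determinants *)

Section gram.
Context (R : realType).

Lemma row_self_ge0 n (v : 'rV[R]_n) : 0 <= (v *m v^T) 0 0.
Proof.
by rewrite mxE; apply: sumr_ge0 => i _; rewrite mxE -expr2 sqr_ge0.
Qed.

Lemma row_self_eq0 n (v : 'rV[R]_n) : (v *m v^T) 0 0 = 0 -> v = 0.
Proof.
rewrite mxE => /eqP; rewrite psumr_eq0; last first.
  by move=> i _; rewrite mxE -expr2 sqr_ge0.
move=> /allP v0; apply/rowP => i; have := v0 i (mem_index_enum _).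
by rewrite mxE -expr2 sqrf_eq0 !mxE => /eqP.
Qed.

(** Along the segment from the identity to J J^T all matrices are positive
    definite, hence invertible. The determinant is a polynomial in the parameter
    that equals 1 at the start, so by the intermediate value theorem it cannot
    be nonpositive at the end. *)
Lemma gram_det_gt0 m n (J : 'M[R]_(m, n)) : row_free J ->
  0 < \det (J *m J^T).
Proof.
move=> Jfree; set G := J *m J^T.
(* The matrix (1 - 'X) I + 'X J J^T. *)
pose P : 'M[{poly R}]_m := \matrix_(i, j)
  (((1%:M : 'M[R]_m) i j)%:P * (1 - 'X) + (G i j)%:P * 'X).
have PE t : (\det P).[t] = \det ((1 - t)%:M + t *: G).
  rewrite -horner_evalE -det_map_mx; congr (\det _).
  apply/matrixP => i j; rewrite !mxE /= horner_evalE !hornerE.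
  by case: eqP => _ /=; rewrite ?mulr1n ?mulr0n; ring.
have P0 : (\det P).[0] = 1 by rewrite PE subr0 scale0r addr0 det1.
have P1 : (\det P).[1] = \det G by rewrite PE subrr scale1r raddf0 add0r.
rewrite ltNge; apply/negP => G0.
have [|t /andP[t0 t1]] := @poly_ivt _ (- \det P) 0 1 ler01.
  by rewrite !hornerN P0 P1 lerN10 oppr_ge0 G0.
rewrite rootN /root PE => /det0P[v v0 vM].
have : (1 - t) * (v *m v^T) 0 0 + t * (v *m J *m (v *m J)^T) 0 0 = 0.
  have := congr1 (fun w : 'rV_m => (w *m v^T) 0 0) vM.
  rewrite mul0mx mulmxDr mul_mx_scalar -scalemxAr mulmxDl -!scalemxAl.
  by rewrite /G trmx_mul !mulmxA mxE [X in X + _]mxE [X in _ + X]mxE [RHS]mxE.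
have := row_self_ge0 v; have := row_self_ge0 (v *m J).
set a := (v *m v^T) 0 0; set b := _ 0 0 => b0 a0 ab0.
have [t_eq1|t_neq1] := eqVneq t 1.
  have : v *m J = 0 by apply: row_self_eq0; rewrite -/b; move: ab0; rewrite t_eq1; lra.
  rewrite -(mul0mx _ J) => /(row_free_inj Jfree) v_eq0.
  by rewrite v_eq0 eqxx in v0.
have t1' : 0 < 1 - t by rewrite subr_gt0 lt_neqAle t_neq1.
have : a = 0 by have := mulr_ge0 t0 b0; nra.
by move=> /row_self_eq0 v_eq0; rewrite v_eq0 eqxx in v0.
Qed.

End gram.

(** * Simplices of a mesh *)

Section simplices.
Context (R : realType) (d : nat) (M : mesh R d).
Implicit Types (S K E : {set 'I_(nvtx M)}).

(** For m = d.-1 this is the matrix face_edges; the general m covers cells, for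
    which m = d, in the same way as faces. *)
Definition edges (m : nat) S : 'M[R]_(m, d) :=
  \matrix_(i, j) (nth 0 (face_pts S) i.+1 - nth 0 (face_pts S) 0) 0 j.

Definition simplex_param m S (t : 'rV[R]_m) : 'rV[R]_d :=
  nth 0 (face_pts S) 0 + t *m edges m S.

Section enumeration.
Variables (m : nat) (S : {set 'I_(nvtx M)}) (i0 : 'I_(nvtx M)).
Hypothesis cS : #|S| = m.+1.
Local Notation e := (nth i0 (enum S)).

Lemma nth_face_pts j : (j < m.+1)%N -> nth 0 (face_pts S) j = vtx (e j).
Proof. by move=> jm; rewrite (nth_map i0) // -cardE cS. Qed.

Lemma sum_enum (V : nmodType) (F : 'I_(nvtx M) -> V) :
  \sum_(i in S) F i = F (e 0%N) + \sum_(j < m) F (e j.+1).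
Proof.
by rewrite -big_enum (big_nth i0) -cardE cS big_mkord big_ord_recl.
Qed.

Lemma mem_enum_nth j : (j < m.+1)%N -> e j \in S.
Proof. by move=> jm; rewrite -mem_enum mem_nth // -cardE cS. Qed.

(** Converts coordinates indexed by the position of a vertex in the enumeration
    of S into a weight on vertices, as used by hull. *)
Lemma enum_fun (b0 : R) (b : 'I_m -> R) :
  exists a : 'I_(nvtx M) -> R, [/\ a (e 0%N) = b0, forall j : 'I_m, a (e j.+1) = b j
    & 0 <= b0 -> (forall j, 0 <= b j) -> forall i, 0 <= a i].
Proof.
exists (fun i => if index i (enum S) is j.+1 then oapp b 0 (insub j) else b0).
have ie j : (j < m.+1)%N -> index (e j) (enum S) = j.
  by move=> jm; rewrite index_uniq ?enum_uniq // -cardE cS.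
split; first by rewrite ie.
- by move=> j; rewrite ie ?ltnS // valK.
- by move=> b00 bj0 i; case: index => // j; case: (insub j) => /=.
Qed.

Lemma mulmx_edges (t : 'rV[R]_m) :
  t *m edges m S = \sum_j t 0 j *: (vtx (e j.+1) - vtx (e 0%N)).
Proof.
rewrite mulmx_sum_row; apply: eq_bigr => j _; congr (_ *: _).
by apply/rowP => i; rewrite !mxE !nth_face_pts // ltnS.
Qed.

End enumeration.

Lemma simplex_inhabited m S : #|S| = m.+1 -> exists i, i \in S.
Proof. by move=> cS; apply/card_gt0P; rewrite cS. Qed.

(** The parameter of a point collects its barycentric coordinates at all vertices
    but the first. *)
Lemma hull_param m S : #|S| = m.+1 ->
  hull S = [set simplex_param S t | t in @ref_simplex R m].
Proof.
move=> cS; have [i0 _] := simplex_inhabited cS.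
apply/seteqP; split => [x [a [a0 a1 ->]]|_ [t [t0 t1] <-]].
  exists (\row_j a (nth i0 (enum S) j.+1)).
    split=> [i|]; first by rewrite mxE.
    under eq_bigr do rewrite mxE.
    by rewrite -a1 (sum_enum i0 cS) lerDr.
  rewrite /simplex_param (mulmx_edges i0 cS) (nth_face_pts i0 cS) //.
  move: a1; rewrite !(sum_enum i0 cS) => a1.
  have -> : a (nth i0 (enum S) 0) = 1 - \sum_(j < m) a (nth i0 (enum S) j.+1).
    by rewrite -a1 addrK.
  rewrite scalerBl scale1r scaler_suml -addrA; congr (_ + _).
  rewrite addrC -sumrB; apply: eq_bigr => j _; by rewrite mxE scalerBr.
have [a [ae0 ae a0]] := enum_fun i0 cS (1 - \sum_j t 0 j) (fun j => t 0 j).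
exists a; split.
- by apply: a0 => //; rewrite subr_ge0.
- by rewrite (sum_enum i0 cS) ae0 [X in _ + X](eq_bigr (fun j => t 0 j)) ?subrK.
- rewrite (sum_enum i0 cS) /simplex_param (mulmx_edges i0 cS) (nth_face_pts i0 cS) //.
  rewrite ae0 scalerBl scale1r scaler_suml -addrA; congr (_ + _).
  by rewrite addrC -sumrB; apply: eq_bigr => j _; rewrite ae scalerBr.
Qed.

(** A relation between the edges from the first vertex is a relation of total
    weight zero between the vertices. *)
Lemma edges_row_free m S : #|S| = m.+1 -> affinely_independent S ->
  row_free (edges m S).
Proof.
move=> cS Sind; have [i0 _] := simplex_inhabited cS.
apply: inj_row_free => v; rewrite (mulmx_edges i0 cS) => v0.
have [a [ae0 ae _]] := enum_fun i0 cS (- \sum_j v 0 j) (fun j => v 0 j).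
apply/rowP => j; rewrite mxE -ae; apply: Sind.
- by rewrite (sum_enum i0 cS) ae0 [X in _ + X](eq_bigr (fun j => v 0 j)) ?addNr.
- rewrite (sum_enum i0 cS) ae0 scaleNr scaler_suml addrC -sumrB -[RHS]v0.
  by apply: eq_bigr => i _; rewrite ae scalerBr.
- by rewrite (mem_enum_nth i0 cS) // ltnS.
Qed.

Lemma sum_extend S E (V : nmodType) (F : 'I_(nvtx M) -> V) : E \subset S ->
  (forall j, j \notin E -> F j = 0) -> \sum_(j in S) F j = \sum_(j in E) F j.
Proof.
move=> /fintype.subsetP ES F0.
rewrite (bigID (mem E)) /= [X in _ + X]big1 ?addr0; last first.
  by move=> j /andP[_ /F0].
by apply: eq_bigl => j; case: (boolP (j \in E)); rewrite ?andbF // => /ES ->.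
Qed.

Lemma affinely_independent_sub S E : E \subset S -> affinely_independent S ->
  affinely_independent E.
Proof.
move=> ES Sind a a0 av i iE.
have := Sind (fun j => if j \in E then a j else 0).
rewrite !(sum_extend ES); last 2 first.
- by move=> j /negbTE ->; rewrite scale0r.
- by move=> j /negbTE ->.
rewrite (eq_bigr a) => [|j ->//]; rewrite (eq_bigr (fun j => a j *: vtx j)) => [|j ->//].
by move=> /(_ a0 av i (fintype.subsetP ES _ iE)); rewrite iE.
Qed.

Lemma hull_sub S E : E \subset S -> hull E `<=` hull S.
Proof.
move=> ES x [a [a0 a1 ->]].
exists (fun j => if j \in E then a j else 0); split.
- by move=> i; case: ifP.
- rewrite (sum_extend ES); first by rewrite -a1; apply: eq_bigr => j ->.
  by move=> j /negbTE ->.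
- rewrite (sum_extend ES); first by apply: eq_bigr => j ->.
  by move=> j /negbTE ->; rewrite scale0r.
Qed.

Lemma hull_bounded S : exists B, hull S `<=` box 0 B.
Proof.
exists (\sum_(i in S) \sum_j `|(vtx i : 'rV[R]_d) 0 j|) => _ [a [a0 a1 ->]] j.
rewrite mxE subr0 summxE; apply: (le_trans (ler_norm_sum _ _ _)).
apply: ler_sum => i iS; rewrite mxE normrM.
apply: (@le_trans _ _ `|(vtx i : 'rV[R]_d) 0 j|).
  rewrite ler_piMl // ger0_norm // -a1 (bigD1 i) //= lerDl.
  by apply: sumr_ge0 => l _.
by rewrite (bigD1 j) //= lerDl sumr_ge0.
Qed.

(** A cell is a polytope: its constraints are the barycentric coordinates of the
    reference simplex composed with the inverse of the parametrization. *)
Lemma body_hull K : #|K| = d.+1 -> affinely_independent K -> body (hull K).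
Proof.
move=> cK Kind; have Junit : edges d K \in unitmx.
  by rewrite -row_free_unit; exact: edges_row_free.
pose psi (x : 'rV[R]_d) := (x - nth 0 (face_pts K) 0) *m invmx (edges d K).
have psiK : cancel (@simplex_param d K) psi.
  by move=> t; rewrite /psi /simplex_param addrAC subrr add0r mulmxK.
have paramK : cancel psi (@simplex_param d K).
  by move=> x; rewrite /psi /simplex_param mulmxKV // addrC subrK.
pose l j x := ref_coord j (psi x).
have hullE : hull K = [set x | forall j, 0 <= l j x].
  rewrite (hull_param cK) ref_simplexE; apply/seteqP; split => x /=.
    by move=> [t tl <-] j; rewrite /l psiK.
  by move=> lx; exists (psi x).
have [B hB] := hull_bounded K.
rewrite hullE; apply: (@polytope_body _ _ _ _ (simplex_param K (ref_center R d)) B).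
- move=> j; have [lp la] := @affine_ref_coord R d j; split.
    apply: (polyfun_comp lp) => i.
    rewrite (_ : (fun _ => _) = (fun x : 'rV_d => \sum_h
      (x 0 h - nth 0 (face_pts K) 0 0 h) * invmx (edges d K) h i)).
      apply: polyfun_sum => h; apply: polyfunM; last exact: polyfun_cst.
      by apply: polyfunB; [exact: polyfun_coord|exact: polyfun_cst].
    by apply/funext => x; rewrite /psi mxE; apply: eq_bigr => h _; rewrite !mxE.
  move=> x y t; rewrite /l -la; congr ref_coord.
  rewrite /psi -mulmxBl scalemxAl -mulmxDl; congr (_ *m _).
  by rewrite opprD opprK (addrA (y - _)) addrAC subrK addrAC.
- by rewrite -hullE.
- by move=> j; rewrite /l psiK; exact: ref_coord_center.
Qed.

Lemma hull_nonempty m S : #|S| = m.+1 -> hull S !=set0.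
Proof.
move=> cS; rewrite (hull_param cS); exists (simplex_param S (0 : 'rV[R]_m)), 0 => //.
split=> [i|]; first by rewrite mxE.
by rewrite big1 // => i _; rewrite mxE.
Qed.

End simplices.

(** * Integration over faces *)

Section faces.
Context (R : realType) (d : nat) (M : mesh R d).
Implicit Types (K E : {set 'I_(nvtx M)}).

Variable E : {set 'I_(nvtx M)}.
Hypotheses (d0 : (0 < d)%N) (cE : #|E| = d) (Eind : affinely_independent E).

Let cE' : #|E| = d.-1.+1. Proof. by rewrite prednK. Qed.

Let area := Num.sqrt (\det (face_edges E *m (face_edges E)^T)).

Let area_gt0 : 0 < area.
Proof. by rewrite sqrtr_gt0; exact/gram_det_gt0/edges_row_free. Qed.

Let hullE : hull E = [set face_param E t | t in @ref_simplex R d.-1].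
Proof. exact: hull_param. Qed.

Let polyfun_param (f : 'rV[R]_d -> R) : polyfun f -> polyfun (f \o face_param E).
Proof.
move=> pf; apply: (polyfun_comp pf) => i.
rewrite (_ : (fun _ => _) = (fun t : 'rV_d.-1 => nth 0 (face_pts E) 0 0 i
   + \sum_h t 0 h * face_edges E h i)).
  apply: polyfunD; first exact: polyfun_cst.
  apply: polyfun_sum => h; apply: polyfunM; last exact: polyfun_cst.
  exact: polyfun_coord.
by apply/funext => t; rewrite /face_param mxE [X in _ + X]mxE.
Qed.

Lemma face_intP (a : R) f g : polyfun f -> polyfun g ->
  face_int E (fun x => a * f x + g x) = a * face_int E f + face_int E g.
Proof.
move=> pf pg; rewrite /face_int mulrCA -mulrDr; congr (_ * _).
exact: (integral_onP (body_ref_simplex R d.-1) a (polyfun_param pf) (polyfun_param pg)).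
Qed.

Lemma eq_face_int f g : (forall x, hull E x -> f x = g x) ->
  face_int E f = face_int E g.
Proof.
rewrite hullE => fg; rewrite /face_int; congr (_ * _).
by apply: eq_integral_on => t rt; apply: fg; exists t.
Qed.

Lemma face_int_ge0 f : (forall x, hull E x -> 0 <= f x) -> 0 <= face_int E f.
Proof.
rewrite hullE => f0; apply: mulr_ge0; first exact: ltW.
by apply: integral_on_ge0 => t rt; apply: f0; exists t.
Qed.

Lemma face_int_eq0 f : polyfun f -> (forall x, hull E x -> 0 <= f x) ->
  face_int E f = 0 -> forall x, hull E x -> f x = 0.
Proof.
rewrite hullE => pf f0 /eqP; rewrite mulf_eq0 (gt_eqF area_gt0) /= => /eqP If0.
move=> _ [t rt <-].
apply: (integral_on_eq0 (body_ref_simplex R d.-1) (polyfun_param pf) _ If0 rt).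
by move=> s rs; apply: f0; exists s.
Qed.

End faces.

(** * Orthogonal projection for a semidefinite form *)

Section orthogonal_projection.
Context (R : realType) (V : lmodType R) (B : V -> V -> R).
Hypothesis BP : forall a u v w, B (a *: u + v) w = a * B u w + B v w.
Hypothesis BC : forall u v, B u v = B v u.
Hypothesis B_ge0 : forall u, 0 <= B u u.

(** Membership in the span of a list is expressed below by membership in every
    subspace that contains the list; no bases or dimensions are involved. *)
Definition linsubspace (Q : V -> Prop) : Prop :=
  Q 0 /\ forall a u v, Q u -> Q v -> Q (a *: u + v).

Let B0 w : B 0 w = 0.
Proof. by have := BP 1 0 0 w; rewrite scaler0 addr0 mul1r => ?; lra. Qed.

Let BN u w : B (- u) w = - B u w.
Proof. by have := BP (-1) u 0 w; rewrite scaleN1r addr0 B0 => ->; ring. Qed.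

Let BD u v w : B (u + v) w = B u w + B v w.
Proof. by have := BP 1 u v w; rewrite scale1r mul1r. Qed.

Let BB u v w : B (u - v) w = B u w - B v w.
Proof. by rewrite BD BN. Qed.

Let BBr u v w : B u (v - w) = B u v - B u w.
Proof. by rewrite BC BB !(BC u). Qed.

Lemma orthogonal_linsubspace u : linsubspace (fun v => B u v = 0).
Proof.
split=> [|a v w uv uw]; first by rewrite BC.
by rewrite BC BP !(BC _ u) uv uw mulr0 addr0.
Qed.

(** The degenerate case of the Cauchy-Schwarz inequality. It occurs for scalar
    products on a face, where polynomials that vanish on the face are
    isotropic. *)
Lemma isotropic_orthogonal u v : B u u = 0 -> B v u = 0.
Proof.
move=> u0; apply/eqP/negPn/negP => vu0.
(* The multiple of u is chosen so that the square of the sum would be -1. *)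
have := B_ge0 ((- (B v v + 1) / (2 * B v u)) *: u + v).
rewrite BP !(BC _ (_ *: u + v)) !BP u0 !(BC u v).
have -> : - (B v v + 1) / (2 * B v u) *
    (- (B v v + 1) / (2 * B v u) * 0 + B v u) +
    (- (B v v + 1) / (2 * B v u) * B v u + B v v) = -1.
  by field; rewrite vu0.
by rewrite ler0N1.
Qed.

(** The Gram-Schmidt process: e' is e minus its projection on the span of s, and
    the projection of g on the span of e :: s adds a multiple of e' to the
    projection on the span of s. *)
Lemma orthogonal_projection (s : seq V) (g : V) : exists p,
  (forall Q, linsubspace Q -> (forall e, e \in s -> Q e) -> Q p) /\
  forall e, e \in s -> B (p - g) e = 0.
Proof.
elim: s g => [|e s IH] g; first by exists 0; split=> // Q [].
have [pe [spe ope]] := IH e; have [p0 [sp0 op0]] := IH g.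
pose e' := e - pe.
have e's f : f \in s -> B e' f = 0.
  by move=> fs; rewrite /e' -opprB BN ope // oppr0.
have e'pe : B e' pe = 0 by apply: (spe _ (orthogonal_linsubspace e')).
have p0pe : B (p0 - g) pe = 0 by apply: (spe _ (orthogonal_linsubspace (p0 - g))).
have e'e : B e' e = B e' e'.
  by rewrite [RHS](BBr e' e pe) e'pe subr0.
have p0e : B (p0 - g) e = B (p0 - g) e'.
  by rewrite [RHS](BBr _ e pe) p0pe subr0.
pose c := - (B (p0 - g) e' / B e' e').
exists (c *: e' + p0); split.
  move=> Q [Q0 QP] Qes.
  have Qs f : f \in s -> Q f by move=> fs; apply: Qes; rewrite inE fs orbT.
  apply: (QP); last exact: (sp0 _ (conj Q0 QP) Qs).
  rewrite /e' addrC -scaleN1r; apply: (QP); first exact: (spe _ (conj Q0 QP) Qs).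
  by apply: Qes; rewrite inE eqxx.
move=> f; rewrite -addrA BP inE => /predU1P[->|fs]; last first.
  by rewrite e's // op0 // mulr0 addr0.
rewrite e'e p0e /c.
(* If e' is isotropic, then c = 0 by division by 0, which is the right value. *)
have [n0|n0] := eqVneq (B e' e') 0; last by field.
by rewrite (isotropic_orthogonal (p0 - g) n0) n0 mulr0 addr0.
Qed.

End orthogonal_projection.

Lemma linsubspace_sum (R : realType) (V : lmodType R) (Q : V -> Prop) (I : Type)
    (r : seq I) (c : I -> R) (F : I -> V) :
  linsubspace Q -> (forall i, Q (F i)) -> Q (\sum_(i <- r) c i *: F i).
Proof.
move=> [Q0 QP] QF; elim: r => [|i r IH]; first by rewrite big_nil.
by rewrite big_cons; apply: (QP).
Qed.

(** * Values of polynomials *)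

Section peval_theory.
Context (R : realType) (d : nat).
Implicit Types (p q : mpoly d R) (v w : 'I_d -> mpoly d R).

Lemma pevalB p q x : peval (p - q) x = peval p x - peval q x.
Proof. by rewrite /peval mevalB. Qed.

Lemma peval0 x : peval (0 : mpoly d R) x = 0.
Proof. by rewrite /peval meval0. Qed.

Lemma pevalP a p q x : peval (a *: p + q) x = a * peval p x + peval q x.
Proof. by rewrite /peval mevalD mevalZ. Qed.

Lemma peval_divergenceP a v w x :
  peval (divergence (fun i => a *: v i + w i)) x =
  a * peval (divergence v) x + peval (divergence w) x.
Proof.
rewrite -pevalP; congr peval; rewrite /divergence scaler_sumr -big_split.
by apply: eq_bigr => i _; rewrite linearP.
Qed.

Lemma vdotP a v w n x :
  vdot (fun i => a *: v i + w i) n x = a * vdot v n x + vdot w n x.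
Proof.
rewrite /vdot mulr_sumr -big_split; apply: eq_bigr => i _.
by rewrite /= pevalP; ring.
Qed.

Lemma polyfun_vdot v n : polyfun (vdot v n).
Proof.
apply: polyfun_sum => i; apply: polyfunM; first exact: polyfun_peval.
exact: polyfun_cst.
Qed.

Lemma deg_leP k a p q : deg_le k p -> deg_le k q -> deg_le k (a *: p + q).
Proof.
rewrite /deg_le => pk qk; apply: (leq_trans (mmeasureD_le _ _ _)).
rewrite geq_max qk andbT; exact: leq_trans (mmeasureZ_le _ _ _) pk.
Qed.

Lemma deg_le0 k : deg_le k (0 : mpoly d R).
Proof. by rewrite /deg_le mmeasure0. Qed.

Lemma deg_leB k p q : deg_le k p -> deg_le k q -> deg_le k (p - q).
Proof. by move=> pk qk; rewrite addrC -scaleN1r; exact: deg_leP. Qed.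

End peval_theory.

(** * Integrals and face projections on a simplicial mesh *)

Section simplicial_mesh.
Context (R : realType) (d : nat) (M : mesh R d) (k : nat).
Hypotheses (d0 : (0 < d)%N) (simM : simplicial M).
Local Notation simplex := {set 'I_(nvtx M)}.
Implicit Types (K E : simplex).

Lemma body_cell K : K \in cells M -> body (hull K).
Proof. by move=> /simM[]; exact: body_hull. Qed.

(** Makes the weight of the stabilization positive, so that it controls the
    jump between the projected trace and the face unknown. *)
Lemma hK_gt0 K : K \in cells M -> 0 < hK K.
Proof.
move=> KM; apply: body_diam_gt0 => //; first exact: body_cell.
by have [cK _] := simM KM; exact: hull_nonempty cK.
Qed.

Lemma cell_face K E : K \in cells M -> E \in faces_of K ->
  [/\ #|E| = d, affinely_independent E & hull E `<=` hull K].
Proof.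
move=> /simM[_ Kind]; rewrite inE => /andP[EK /eqP cE]; split=> //.
  exact: affinely_independent_sub EK Kind.
exact: hull_sub.
Qed.

Section volume.
Implicit Types F G : simplex -> 'rV[R]_d -> R.

Lemma volP a F G : (forall K, polyfun (F K)) -> (forall K, polyfun (G K)) ->
  vol (fun K x => a * F K x + G K x) = a * vol F + vol G.
Proof.
move=> pF pG; rewrite /vol mulr_sumr -big_split; apply: eq_bigr => K KM /=.
exact: (integral_onP (body_cell KM) a (pF K) (pG K)).
Qed.

Lemma volZ a F : (forall K, polyfun (F K)) ->
  vol (fun K x => a * F K x) = a * vol F.
Proof.
move=> pF; rewrite /vol mulr_sumr; apply: eq_bigr => K KM.
have p0 : @polyfun R d (fun=> 0) by exact: polyfun_cst.
have I0 : cell_int K (fun=> 0 : R) = 0.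
  have : cell_int K (fun=> 0) = -1 * cell_int K (fun=> 0) + cell_int K (fun=> 0 : R).
    rewrite /cell_int -(integral_onP (body_cell KM)) //.
    by apply: eq_integral_on => x _; rewrite mulr0 addr0.
  by lra.
rewrite -[RHS]addr0 -I0 -[RHS](integral_onP (body_cell KM) a (pF K) p0).
by apply: eq_integral_on => x _; rewrite addr0.
Qed.

Lemma eq_vol F G : (forall K x, K \in cells M -> hull K x -> F K x = G K x) ->
  vol F = vol G.
Proof.
by move=> FG; apply: eq_bigr => K KM; apply: eq_integral_on => x; exact: FG.
Qed.

Lemma vol0 F : (forall K x, K \in cells M -> hull K x -> F K x = 0) ->
  vol F = 0.
Proof.
move=> F0; have p0 (K : simplex) : @polyfun R d (fun=> 0) by exact: polyfun_cst.
rewrite -[RHS](mul0r (vol (M := M) (fun=> fun=> 0))) -(volZ 0 p0).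
by apply: eq_vol => K x KM Kx; rewrite F0 // mulr0.
Qed.

Lemma vol_ge0 F : (forall K x, K \in cells M -> hull K x -> 0 <= F K x) ->
  0 <= vol F.
Proof.
by move=> F0; apply: sumr_ge0 => K KM; apply: integral_on_ge0 => x; exact: F0.
Qed.

Lemma vol_eq0 F : (forall K, polyfun (F K)) ->
  (forall K x, K \in cells M -> hull K x -> 0 <= F K x) ->
  vol F = 0 -> forall K x, K \in cells M -> hull K x -> F K x = 0.
Proof.
move=> pF F0 /eqP; rewrite psumr_eq0; last first.
  by move=> K KM; apply: integral_on_ge0 => x; exact: F0.
move=> /allP IF0 K x KM; apply: (integral_on_eq0 (body_cell KM) (pF K)).
  by move=> y; exact: F0.
by have := IF0 K (mem_index_enum _); rewrite KM => /eqP.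
Qed.

End volume.

Section boundary.
Implicit Types F G : simplex -> simplex -> 'rV[R]_d -> R.

Lemma bdrP a F G : (forall K E, polyfun (F K E)) ->
  (forall K E, polyfun (G K E)) ->
  bdr (fun K E x => a * F K E x + G K E x) = a * bdr F + bdr G.
Proof.
move=> pF pG; rewrite /bdr mulr_sumr -big_split; apply: eq_bigr => K KM /=.
rewrite mulr_sumr -big_split; apply: eq_bigr => E EK /=.
exact: face_intP.
Qed.

Lemma eq_bdr F G :
  (forall K E x, K \in cells M -> E \in faces_of K -> hull E x ->
     F K E x = G K E x) -> bdr F = bdr G.
Proof.
move=> FG; apply: eq_bigr => K KM; apply: eq_bigr => E EK.
have [cE Eind _] := cell_face KM EK.
by apply: eq_face_int => // x; exact: FG.
Qed.

Lemma bdr_ge0 F :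
  (forall K E x, K \in cells M -> E \in faces_of K -> hull E x ->
     0 <= F K E x) -> 0 <= bdr F.
Proof.
move=> F0; apply: sumr_ge0 => K KM; apply: sumr_ge0 => E EK.
have [cE Eind _] := cell_face KM EK.
by apply: face_int_ge0 => // x; exact: F0.
Qed.

Lemma bdr_eq0 F : (forall K E, polyfun (F K E)) ->
  (forall K E x, K \in cells M -> E \in faces_of K -> hull E x ->
     0 <= F K E x) ->
  bdr F = 0 -> forall K E x, K \in cells M -> E \in faces_of K -> hull E x ->
  F K E x = 0.
Proof.
move=> pF F0.
have f0 K E : K \in cells M -> E \in faces_of K -> 0 <= face_int E (F K E).
  move=> KM EK; have [cE Eind _] := cell_face KM EK.
  by apply: face_int_ge0 => // x; exact: F0.
move=> /eqP; rewrite psumr_eq0; last by move=> K KM; apply: sumr_ge0 => E; exact: f0.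
move=> /allP IF0 K E x KM EK; have [cE Eind _] := cell_face KM EK.
apply: (face_int_eq0 d0 cE Eind (pF K E)); first by move=> y; exact: F0.
have := IF0 K (mem_index_enum _); rewrite KM /= psumr_eq0; last by move=> *; exact: f0.
by move=> /allP/(_ E (mem_index_enum _)); rewrite EK => /eqP.
Qed.

End boundary.

Section face_projection.
Variable E : simplex.
Hypotheses (cE : #|E| = d) (Eind : affinely_independent E).
Implicit Types p q : mpoly d R.

Let B p q := face_int E (fun x => peval p x * peval q x).

Let BP a p q r : B (a *: p + q) r = a * B p r + B q r.
Proof.
rewrite /B -face_intP.
- by apply: eq_face_int => // x _; rewrite pevalP; ring.
- by apply: polyfunM; exact: polyfun_peval.
- by apply: polyfunM; exact: polyfun_peval.
Qed.

Let BC p q : B p q = B q p.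
Proof. by apply: eq_face_int => // x _; rewrite mulrC. Qed.

Let B_ge0 p : 0 <= B p p.
Proof. by apply: face_int_ge0 => // x _; rewrite -expr2 sqr_ge0. Qed.

Let B_eq0 p : B p p = 0 -> forall x, hull E x -> peval p x = 0.
Proof.
move=> Bp0 x Ex; apply/eqP; rewrite -(sqrf_eq0 (peval p x)) expr2; apply/eqP.
apply: (face_int_eq0 d0 cE Eind _ _ Bp0 Ex).
  by apply: polyfunM; exact: polyfun_peval.
by move=> y _; rewrite -expr2 sqr_ge0.
Qed.

(** Orthogonality to the finitely many monomials of degree at most k suffices. *)
Lemma face_proj_exists p : exists s, is_face_proj k E (peval p) s.
Proof.
pose s := [seq mpolyX R (bmnm m) | m : bmultinom d k.+1].
have [q [qs qp]] := orthogonal_projection BP BC B_ge0 s p.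
exists q; split.
  apply: qs.
    by split=> [|a u v]; [exact: deg_le0|exact: deg_leP].
  by move=> _ /mapP[m _ ->]; rewrite /deg_le mmeasureX; exact: bmdeg.
move=> m mk.
rewrite -[RHS](_ : B (q - p) m = 0).
  by apply: eq_face_int => // x _; rewrite pevalB.
rewrite (mpolywE mk).
apply: (linsubspace_sum _ _ (orthogonal_linsubspace BP BC (q - p))).
by move=> i; apply: qp; apply/mapP; exists i => //; rewrite mem_enum.
Qed.

Let BB p q r : B (p - q) r = B p r - B q r.
Proof. by rewrite addrC -scaleN1r BP; ring. Qed.

Let pr p := xget (0 : mpoly d R) [set s | is_face_proj k E (peval p) s].

Let pr_deg p : deg_le k (pr p) /\ forall m, deg_le k m -> B (pr p - p) m = 0.
Proof.
have [s sp] := face_proj_exists p.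
have [pk pp] : is_face_proj k E (peval p) (pr p).
  exact: (xgetPex 0 (P := [set s | is_face_proj k E (peval p) s]) (ex_intro _ s sp)).
split=> // m mk; rewrite -(pp _ mk).
by apply: eq_face_int => // x _; rewrite pevalB.
Qed.

(** The difference of both sides is a polynomial r of degree at most k which is
    orthogonal to all such polynomials, in particular to itself. *)
Lemma face_projP a p q x : hull E x -> face_proj k E (a *: p + q) x =
  a * face_proj k E p x + face_proj k E q x.
Proof.
move=> Ex; rewrite /face_proj -/(pr _) -/(pr p) -/(pr q) -pevalP.
apply/eqP; rewrite -subr_eq0 -pevalB; apply/eqP; apply: B_eq0 Ex.
have [rk ro] := pr_deg (a *: p + q).
have [pk po] := pr_deg p; have [qk qo] := pr_deg q.
set r := _ - _; have rk' : deg_le k r by apply: deg_leB => //; exact: deg_leP.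
rewrite {1}/r (_ : _ - _ = (pr (a *: p + q) - (a *: p + q)) -
   (a *: (pr p - p) + (pr q - q))).
  by rewrite BB BP ro // po // qo // mulr0 addr0 subrr.
have -> : a *: (pr p - p) + (pr q - q) = a *: pr p + pr q - (a *: p + q).
  by rewrite scalerBr addrACA -opprD.
by rewrite opprB addrA subrK.
Qed.

Lemma face_proj_eq0 p : (forall x, hull E x -> peval p x = 0) ->
  forall x, hull E x -> face_proj k E p x = 0.
Proof.
move=> p0; have [pk /(_ _ pk)] := pr_deg p.
rewrite BB (_ : B p (pr p) = 0) ?subr0; first exact: B_eq0.
transitivity (B (p - p) (pr p)); last by rewrite BB subrr.
by apply: eq_face_int => // x Ex; rewrite subrr p0 // peval0.
Qed.

End face_projection.
End simplicial_mesh.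

(** * The bilinear forms of the scheme *)

Ltac solve_polyfun := repeat first
  [ exact: polyfun_peval | exact: polyfun_vdot | exact: polyfun_cst
  | apply: polyfun_sum => ? | apply: polyfunX | apply: polyfunN
  | apply: polyfunM | apply: polyfunD | move=> ? ].

Section bilinear_forms.
Context (R : realType) (d : nat) (M : mesh R d) (k : nat).
Hypotheses (d0 : (0 < d)%N) (simM : simplicial M).
Local Notation simplex := {set 'I_(nvtx M)}.
Implicit Types (K E : simplex) (q r v : pwv M) (u w m : pw M).

(** Linear combinations are formed polynomial by polynomial; a = -1 gives
    differences of piecewise polynomials. *)
Definition pwP a u w : pw M := fun K => a *: u K + w K.
Definition pwvP a q r : pwv M := fun K i => a *: q K i + r K i.
Definition pw0 : pw M := fun=> 0.
Definition pwv0 : pwv M := fun _ _ => 0.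

Definition l2v q r := vol (fun K x => \sum_i peval (q K i) x * peval (r K i) x).
Definition l2w u w := vol (fun K x => peval (u K) x * peval (w K) x).
Definition divf u r :=
  vol (fun K x => peval (u K) x * peval (divergence (r K)) x).
Definition trf m r :=
  bdr (fun K E x => peval (m E) x * vdot (r K) (unit_normal K E) x).
Definition stab u m w n := bdr (fun K E x =>
  (hK K)^-1 * (face_proj k E (u K) x - peval (m E) x)
            * (face_proj k E (w K) x - peval (n E) x)).

(** The two middle pairs of terms trade places, with opposite signs, when the
    two groups of arguments are exchanged. *)
Lemma opAE q u m r w n : opA k q u m r w n =
  l2v q r - divf u r + trf m r + divf w q - trf n q + stab u m w n.
Proof.
rewrite /opA /divf /trf; congr (_ + _ - _ + _).
  by apply: eq_vol => K x _ _; rewrite mulrC.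
by apply: eq_bdr => // K E x _ _ _; rewrite mulrC.
Qed.

Lemma l2vC q r : l2v q r = l2v r q.
Proof.
by apply: eq_vol => K x _ _; apply: eq_bigr => i _; rewrite mulrC.
Qed.

Lemma l2wC u w : l2w u w = l2w w u.
Proof. by apply: eq_vol => K x _ _; rewrite mulrC. Qed.

Lemma stabC u m w n : stab u m w n = stab w n u m.
Proof. by apply: eq_bdr => // K E x _ _ _; rewrite mulrAC. Qed.

Lemma l2vP a q q' r : l2v (pwvP a q q') r = a * l2v q r + l2v q' r.
Proof.
rewrite -volP //; try by solve_polyfun.
apply: eq_vol => K x _ _; rewrite mulr_sumr -big_split.
by apply: eq_bigr => i _; rewrite pevalP mulrDl mulrA.
Qed.

Lemma l2wP a u u' w : l2w (pwP a u u') w = a * l2w u w + l2w u' w.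
Proof.
rewrite -volP //; try by solve_polyfun.
by apply: eq_vol => K x _ _; rewrite pevalP mulrDl mulrA.
Qed.

Lemma divfPl a u u' r : divf (pwP a u u') r = a * divf u r + divf u' r.
Proof.
rewrite -volP //; try by solve_polyfun.
by apply: eq_vol => K x _ _; rewrite pevalP mulrDl mulrA.
Qed.

Lemma divfPr a u r r' : divf u (pwvP a r r') = a * divf u r + divf u r'.
Proof.
rewrite -volP //; try by solve_polyfun.
by apply: eq_vol => K x _ _; rewrite peval_divergenceP mulrDr mulrCA.
Qed.

Lemma trfPl a m m' r : trf (pwP a m m') r = a * trf m r + trf m' r.
Proof.
rewrite -bdrP //; try by solve_polyfun.
by apply: eq_bdr => // K E x _ _ _; rewrite pevalP mulrDl mulrA.
Qed.

Lemma trfPr a m r r' : trf m (pwvP a r r') = a * trf m r + trf m r'.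
Proof.
rewrite -bdrP //; try by solve_polyfun.
by apply: eq_bdr => // K E x _ _ _; rewrite vdotP mulrDr mulrCA.
Qed.

Lemma stabP a u u' m m' w n :
  stab (pwP a u u') (pwP a m m') w n = a * stab u m w n + stab u' m' w n.
Proof.
rewrite -bdrP //; try by solve_polyfun.
apply: eq_bdr => // K E x KM EK Ex; have [cE Eind _] := cell_face simM KM EK.
rewrite face_projP // pevalP.
move: (face_proj _ _ _ _) (face_proj _ _ _ _) (face_proj _ _ _ _) => y y' z.
by move: (peval _ _) (peval _ _) (peval _ _) => t t' t''; ring.
Qed.

Lemma opAP a q q' u u' m m' r w n :
  opA k (pwvP a q q') (pwP a u u') (pwP a m m') r w n =
  a * opA k q u m r w n + opA k q' u' m' r w n.
Proof.
rewrite !opAE l2vP divfPl divfPr trfPl trfPr stabP.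
move: (l2v q r) (l2v q' r) (divf u r) (divf u' r) (divf w q) (divf w q').
move: (trf m r) (trf m' r) (trf n q) (trf n q') (stab u m w n) (stab u' m' w n).
by move=> *; ring.
Qed.

Let pw0P : pw0 = pwP (-1) pw0 pw0.
Proof. by apply/funext => K; rewrite /pwP scaler0 addr0. Qed.

Let pwv0P : pwv0 = pwvP (-1) pwv0 pwv0.
Proof. by apply/funext => K; apply/funext => i; rewrite /pwvP scaler0 addr0. Qed.

Lemma l2v0 q : l2v q pwv0 = 0.
Proof. by rewrite l2vC pwv0P l2vP mulN1r addNr. Qed.

Lemma divf0l r : divf pw0 r = 0.
Proof. by rewrite pw0P divfPl mulN1r addNr. Qed.

Lemma divf0r u : divf u pwv0 = 0.
Proof. by rewrite pwv0P divfPr mulN1r addNr. Qed.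

Lemma trf0l r : trf pw0 r = 0.
Proof. by rewrite pw0P trfPl mulN1r addNr. Qed.

Lemma trf0r m : trf m pwv0 = 0.
Proof. by rewrite pwv0P trfPr mulN1r addNr. Qed.

Lemma stab0 u m : stab u m pw0 pw0 = 0.
Proof. by rewrite stabC pw0P stabP mulN1r addNr. Qed.

Lemma l2v_ge0 q : 0 <= l2v q q.
Proof.
by apply: vol_ge0 => K x _ _; apply: sumr_ge0 => i _; rewrite -expr2 sqr_ge0.
Qed.

Lemma l2v_eq0 q : l2v q q = 0 ->
  forall K, K \in cells M -> forall x, hull K x -> forall i, peval (q K i) x = 0.
Proof.
move=> q0 K KM x Kx i.
have s0 j : true -> 0 <= peval (q K j) x * peval (q K j) x.
  by rewrite -expr2 sqr_ge0.
have /eqP : \sum_j peval (q K j) x * peval (q K j) x = 0.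
  apply: (vol_eq0 simM _ _ q0 KM Kx); first by solve_polyfun.
  by move=> L y _ _; apply: sumr_ge0 => j _; rewrite -expr2 sqr_ge0.
rewrite psumr_eq0 // => /allP/(_ i (mem_index_enum _)) /=.
by rewrite -expr2 sqrf_eq0 => /eqP.
Qed.

Lemma l2w_eq0 u : l2w u u = 0 ->
  forall K, K \in cells M -> forall x, hull K x -> peval (u K) x = 0.
Proof.
move=> u0 K KM x Kx; apply/eqP; rewrite -(sqrf_eq0 (peval _ x)) expr2; apply/eqP.
apply: (vol_eq0 simM _ _ u0 KM Kx); first by solve_polyfun.
by move=> L y _ _; rewrite -expr2 sqr_ge0.
Qed.

Lemma stab_ge0 u m : 0 <= stab u m u m.
Proof.
apply: bdr_ge0 => // K E x KM _ _.
rewrite -mulrA -expr2 mulr_ge0 ?sqr_ge0 // invr_ge0 ltW //; exact: hK_gt0.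
Qed.

Lemma stab_eq0 u m : stab u m u m = 0 ->
  forall K E, K \in cells M -> E \in faces_of K -> forall x, hull E x ->
  face_proj k E (u K) x = peval (m E) x.
Proof.
move=> s0 K E KM EK x Ex.
have pos L F y : L \in cells M -> F \in faces_of L -> hull F y -> 0 <=
    (hK L)^-1 * (face_proj k F (u L) y - peval (m F) y)
              * (face_proj k F (u L) y - peval (m F) y).
  move=> LM _ _.
  by rewrite -mulrA -expr2 mulr_ge0 ?sqr_ge0 // invr_ge0 ltW // hK_gt0.
have pol L F : polyfun (fun y =>
    (hK L)^-1 * (face_proj k F (u L) y - peval (m F) y)
              * (face_proj k F (u L) y - peval (m F) y)) by solve_polyfun.
have /eqP := bdr_eq0 d0 simM pol pos s0 KM EK Ex.
rewrite -mulrA mulf_eq0 invr_eq0 gt_eqF ?hK_gt0 //= -expr2 sqrf_eq0.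
by rewrite subr_eq0 => /eqP.
Qed.

(** With stab_square, a Cauchy-Schwarz inequality free of square roots, whose
    weights a and b are chosen in the energy estimate. *)
Lemma l2v_square a b q r :
  0 <= a ^+ 2 * l2v q q + 2 * a * b * l2v q r + b ^+ 2 * l2v r r.
Proof.
have l2vPr c s t t' : l2v s (pwvP c t t') = c * l2v s t + l2v s t'.
  by rewrite l2vC l2vP !(l2vC _ s).
have := l2v_ge0 (pwvP a q (pwvP b r pwv0)).
rewrite !(l2vP, l2vPr) !l2v0 !(l2vC pwv0) !l2v0 (l2vC r q).
by congr (_ <= _); ring.
Qed.

Lemma stab_square a b u m w n :
  0 <= a ^+ 2 * stab u m u m + 2 * a * b * stab u m w n + b ^+ 2 * stab w n w n.
Proof.
have stabPr c (v l v' l' w' n' : pw M) : stab w' n' (pwP c v v') (pwP c l l') =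
    c * stab w' n' v l + stab w' n' v' l'.
  by rewrite stabC stabP !(stabC _ _ w').
have := stab_ge0 (pwP a u (pwP b w pw0)) (pwP a m (pwP b n pw0)).
rewrite !(stabP, stabPr) !stab0 !(stabC pw0) !stab0 (stabC w n u).
by congr (_ <= _); ring.
Qed.

End bilinear_forms.

(** * Energy estimate *)

Section energy.
Context (R : realType).

(** Strict monotonicity of the cube, quantified by
    a^2 + a b + b^2 = (a - b)^2 / 4 + 3 (a + b)^2 / 4. *)
Lemma cube_monotone (a b : R) :
  (a - b) ^+ 2 ^+ 2 / 4 <= (a ^+ 3 - b ^+ 3) * (a - b).
Proof.
rewrite -subr_ge0 (_ : _ - _ = (a - b) ^+ 2 * (3 / 4 * (a + b) ^+ 2)).
  by apply: mulr_ge0; [exact: sqr_ge0|rewrite mulr_ge0 ?sqr_ge0].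
by field.
Qed.

(** Here NU stands for (u1^3 - u2^3, u), U for |u|^2 and W for (u, phi). The
    identities give NU + l dt X + eps^2 Q + eps dt P = 0. After multiplication by
    2 eps, the quadratic inequality times dt bounds the term in X from below by
    - dt eps^2 P - dt l^2 Q, and dt l^2 Q is at most eps^3 Q, so that half of
    the dissipation remains. *)
Lemma energy_estimate (P Q X U NU W dt eps l : R) :
  0 < eps -> 0 < dt -> l ^+ 2 * dt <= eps ^+ 3 ->
  0 <= P -> 0 <= Q -> 0 <= NU ->
  0 <= eps ^+ 2 * P + 2 * eps * l * X + l ^+ 2 * Q ->
  dt^-1 * W + P = 0 -> eps^-1 * (NU - l * U) + eps * Q - W = 0 ->
  dt^-1 * U + X = 0 -> [/\ P = 0, Q = 0 & NU = 0].
Proof.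
move=> eps0 dt0 ldt P0 Q0 NU0 sq E1 E2 E3.
have WE : W = - dt * P.
  have -> : W = dt * (dt^-1 * W + P) - dt * P by field; rewrite gt_eqF.
  by rewrite E1; ring.
have UE : U = - dt * X.
  have -> : U = dt * (dt^-1 * U + X) - dt * X by field; rewrite gt_eqF.
  by rewrite E3; ring.
have bal : NU + l * dt * X + eps ^+ 2 * Q + eps * dt * P = 0.
  have -> : NU + l * dt * X + eps ^+ 2 * Q + eps * dt * P =
     eps * (eps^-1 * (NU - l * U) + eps * Q - W).
    by rewrite WE UE; field; rewrite gt_eqF.
  by rewrite E2 mulr0.
have tot : 2 * eps * NU + eps ^+ 3 * Q + eps ^+ 2 * dt * P <= 0.
  have := mulr_ge0 (ltW dt0) sq.
  have : 0 <= (eps ^+ 3 - l ^+ 2 * dt) * Q by rewrite mulr_ge0 // subr_ge0.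
  have : 2 * eps * (NU + l * dt * X + eps ^+ 2 * Q + eps * dt * P) = 0.
    by rewrite bal mulr0.
  lra.
have aP : 0 <= eps ^+ 2 * dt * P by rewrite !mulr_ge0 ?exprn_ge0 // ltW.
have aQ : 0 <= eps ^+ 3 * Q by rewrite mulr_ge0 // exprn_ge0 // ltW.
have aN : 0 <= 2 * eps * NU by rewrite !mulr_ge0 // ltW.
have zero c (y : R) : 0 < c -> c * y = 0 -> y = 0.
  by move=> c0 /eqP; rewrite mulf_eq0 gt_eqF //= => /eqP.
split.
- apply: (@zero (eps ^+ 2 * dt)); first by rewrite mulr_gt0 // exprn_gt0.
  lra.
- by apply: (@zero (eps ^+ 3)); [exact: exprn_gt0|lra].
- by apply: (@zero (2 * eps)); [exact: mulr_gt0|lra].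
Qed.

End energy.

(** * Uniqueness of one step and of the scheme *)

Section one_step.
Context (R : realType) (d : nat) (M : mesh R d) (k : nat).
Hypotheses (d0 : (0 < d)%N) (simM : simplicial M).
Variables (f : R -> R -> R) (l c eps dt : R).
Hypothesis fE : forall a b, f a b = a ^+ 3 - l * a - c * b.
Hypotheses (eps0 : 0 < eps) (dt0 : 0 < dt) (ldt : l ^+ 2 * dt <= eps ^+ 3).

(** Equality as elements of L^2, which is all that the scheme sees of the
    previous step. *)
Definition agree (u u' : pw M) : Prop :=
  forall K, K \in cells M -> forall x, hull K x -> peval (u K) x = peval (u' K) x.

Definition step_equations (u0 : pw M) (s : state M) : Prop :=
  forall (r1 : pwv M) (w1 m1 : pw M) (r2 : pwv M) (w2 m2 : pw M),
  in_V k r1 -> in_W k w1 -> in_M k m1 ->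
  in_V k r2 -> in_W k w2 -> in_M k m2 ->
  vol (fun K x => (peval (su s K) x - peval (u0 K) x) / dt * peval (w1 K) x)
    + opA k (sp s) (sphi s) (sphih s) r1 w1 m1 = 0 /\
  vol (fun K x =>
         eps^-1 * f (peval (su s K) x) (peval (u0 K) x) * peval (w2 K) x)
    + eps * opA k (sq s) (su s) (suh s) r2 w2 m2
    - vol (fun K x => peval (sphi s K) x * peval (w2 K) x) = 0.

Variables (u0 u0' : pw M) (s s' : state M).
Hypotheses (u00 : agree u0 u0') (ss : in_spaces k s) (ss' : in_spaces k s').
Hypotheses (eqs : step_equations u0 s) (eqs' : step_equations u0' s').

Let p := pwvP (-1) (sp s') (sp s).
Let phi := pwP (-1) (sphi s') (sphi s).
Let phih := pwP (-1) (sphih s') (sphih s).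
Let q := pwvP (-1) (sq s') (sq s).
Let u := pwP (-1) (su s') (su s).
Let uh := pwP (-1) (suh s') (suh s).

Let cubes w := vol (fun K x =>
  (peval (su s K) x ^+ 3 - peval (su s' K) x ^+ 3) * peval (w K) x).

Let in_V0 : in_V k (@pwv0 R d M).
Proof. by move=> K _ i; exact: deg_le0. Qed.

Let in_W0 : in_W k (@pw0 R d M).
Proof. by move=> K _; exact: deg_le0. Qed.

Let in_M0 : in_M k (@pw0 R d M).
Proof. by move=> K _; exact: deg_le0. Qed.

Let in_diff : [/\ in_V k p, in_W k phi & in_M k phih] /\
  [/\ in_V k q, in_W k u & in_M k uh].
Proof.
have [[pV phiW phihM] [qV uW uhM]] := ss.
have [[pV' phiW' phihM'] [qV' uW' uhM']] := ss'.
by split; split=> [K KM i|K KM|E EM]; apply: deg_leP; auto.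
Qed.

(** The first equation is linear, and the values at the previous step cancel. *)
Let mass_equation r w n : in_V k r -> in_W k w -> in_M k n ->
  dt^-1 * l2w u w + opA k p phi phih r w n = 0.
Proof.
move=> rV wW nM.
have [e _] := eqs rV wW nM rV wW nM; have [e' _] := eqs' rV wW nM rV wW nM.
rewrite opAP // -(volZ simM) //; last by solve_polyfun.
rewrite (_ : vol _ = -1 * vol (fun K x =>
    (peval (su s' K) x - peval (u0' K) x) / dt * peval (w K) x) +
  vol (fun K x => (peval (su s K) x - peval (u0 K) x) / dt * peval (w K) x)).
  by move: e e'; lra.
rewrite -volP //; try by solve_polyfun.
by apply: eq_vol => K x KM Kx; rewrite pevalP (u00 KM Kx); ring.
Qed.

(** In the second equation only the cubic part of f is not linear. *)
Let potential_equation r w n : in_V k r -> in_W k w -> in_M k n ->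
  eps^-1 * (cubes w - l * l2w u w) + eps * opA k q u uh r w n - l2w phi w = 0.
Proof.
move=> rV wW nM.
have [_ e] := eqs rV wW nM rV wW nM; have [_ e'] := eqs' rV wW nM rV wW nM.
rewrite opAP // [l2w phi w]l2wP //.
rewrite (_ : eps^-1 * _ = -1 * vol (fun K x =>
    eps^-1 * f (peval (su s' K) x) (peval (u0' K) x) * peval (w K) x) +
  vol (fun K x =>
    eps^-1 * f (peval (su s K) x) (peval (u0 K) x) * peval (w K) x)).
  by move: e e'; rewrite /l2w; lra.
have pf t v : polyfun (fun x : 'rV[R]_d => eps^-1 * f (peval t x) (peval v x)).
  rewrite (_ : (fun _ => _) = (fun x =>
     eps^-1 * (peval t x ^+ 3 - l * peval t x - c * peval v x))).
    by solve_polyfun.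
  by apply/funext => x; rewrite fE.
rewrite -volP //; try by move=> K; apply: polyfunM; [exact: pf|exact: polyfun_peval].
rewrite addrC -mulNr -volP //; try by solve_polyfun.
rewrite -volZ //; try by solve_polyfun.
by apply: eq_vol => K x KM Kx; rewrite !fE pevalP (u00 KM Kx); ring.
Qed.

(** The differences p, phi, phih, q, u, uh satisfy the three identities that
    energy_estimate requires; E1, E2 and E3 below are these identities. *)
Lemma step_unique : same_state s s' /\ agree (su s) (su s').
Proof.
have [[pV phiW phihM] [qV uW uhM]] := in_diff.
pose X := l2v q p + stab k phi phih u uh.
have E1 : dt^-1 * l2w u phi + (l2v p p + stab k phi phih phi phih) = 0.
  by have := mass_equation pV phiW phihM; rewrite opAE //; lra.
have E2 : eps^-1 * (cubes u - l * l2w u u) +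
    eps * (l2v q q + stab k u uh u uh) - l2w u phi = 0.
  have := potential_equation qV uW uhM; rewrite opAE // (l2wC phi).
  by move=> <-; ring.
(* The mixed terms between fluxes and scalar unknowns in E3 are expressed through
   (q, p) by testing one equation with the flux of the other alone. *)
have flux_q : l2v q p - divf u p + trf uh p = 0.
  have := potential_equation pV in_W0 in_M0.
  rewrite opAE // divf0l // trf0l // stab0 //.
  rewrite /cubes /l2w !(vol0 simM) => [|K x _ _|K x _ _|K x _ _]; try by rewrite peval0 mulr0.
  rewrite mulr0 subrr mulr0 add0r subr0 !addr0 subr0 => /eqP.
  by rewrite mulf_eq0 gt_eqF //= => /eqP.
have flux_p : l2v p q - divf phi q + trf phih q = 0.
  have := mass_equation qV in_W0 in_M0.
  rewrite opAE // divf0l // trf0l // stab0 //.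
  rewrite /l2w (vol0 simM) => [|K x _ _]; last by rewrite peval0 mulr0.
  by rewrite mulr0 add0r !addr0 subr0.
have E3 : dt^-1 * l2w u u + X = 0.
  have := mass_equation in_V0 uW uhM.
  rewrite opAE // l2v0 // divf0r // trf0r //.
  by move=> <-; move: flux_q; rewrite /X; lra.
have uE K x : peval (u K) x = peval (su s K) x - peval (su s' K) x.
  by rewrite pevalP mulN1r addrC.
have cubes_ge0 K x :
    0 <= (peval (su s K) x ^+ 3 - peval (su s' K) x ^+ 3) * peval (u K) x.
  by rewrite uE; apply: le_trans (cube_monotone _ _); rewrite divr_ge0 ?sqr_ge0.
have NU_ge0 : 0 <= cubes u.
  by apply: vol_ge0 => K x _ _; exact: cubes_ge0.
have := l2v_square simM eps l p q.
have := stab_square k d0 simM eps l phi phih u uh.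
rewrite (l2vC p q) => sq1 sq2.
have [|||P0 Q0 NU0] := energy_estimate eps0 dt0 ldt _ _ NU_ge0 _ E1 E2 E3.
- by rewrite addr_ge0 ?l2v_ge0 ?stab_ge0.
- by rewrite addr_ge0 ?l2v_ge0 ?stab_ge0.
- by rewrite /X; move: sq1 sq2; lra.
move: P0 Q0 => /eqP; rewrite paddr_eq0 ?l2v_ge0 ?stab_ge0 //.
move=> /andP[/eqP p_eq0 /eqP sphi_eq0] /eqP.
rewrite paddr_eq0 ?l2v_ge0 ?stab_ge0 // => /andP[/eqP q_eq0 /eqP su_eq0].
have u_agree : agree (su s) (su s').
  move=> K KM x Kx; apply/eqP; rewrite -subr_eq0 -(sqrf_eq0 (_ - _)).
  rewrite -(sqrf_eq0 (_ ^+ 2)) eq_le sqr_ge0 andbT.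
  have := cube_monotone (peval (su s K) x) (peval (su s' K) x).
  rewrite -!uE (vol_eq0 simM _ _ NU0 KM Kx) //; last by solve_polyfun.
  by rewrite pmulr_lle0 ?invr_gt0.
have u_eq0 K x : K \in cells M -> hull K x -> peval (u K) x = 0.
  by move=> KM Kx; rewrite uE (u_agree K KM x Kx) subrr.
have X0 : X = 0.
  move: E3; rewrite /l2w (vol0 simM) => [|K x KM Kx]; first by rewrite mulr0 add0r.
  by rewrite u_eq0 // mulr0.
(* Testing with (0, phi, phih), every term but |phi|^2 vanishes, since the flux
   terms combine with flux_p into X. *)
have phi_eq0 : l2w phi phi = 0.
  have := potential_equation in_V0 phiW phihM.
  rewrite opAE // l2v0 // divf0r // trf0r // [cubes _](vol0 simM) => [|K x KM Kx]; last first.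
    by rewrite (u_agree K KM x Kx) subrr mul0r.
  rewrite [l2w u phi](vol0 simM) => [|K x KM Kx]; last by rewrite u_eq0 // mul0r.
  move: X0; rewrite /X (l2vC q) (stabC _ d0 simM phi) => X0.
  have -> : 0 - 0 + 0 + divf phi q - trf phih q + stab k u uh phi phih =
     l2v p q + stab k u uh phi phih - (l2v p q - divf phi q + trf phih q) by ring.
  by rewrite X0 flux_p; lra.
have phi0 := l2w_eq0 simM phi_eq0.
have vanish (a b : mpoly d R) x : peval (-1 *: b + a) x = 0 -> peval a x = peval b x.
  by rewrite pevalP mulN1r addrC => /eqP; rewrite subr_eq0 => /eqP.
have trace_eq0 v m : (forall K, K \in cells M -> forall x, hull K x -> peval (v K) x = 0) ->
    stab k v m v m = 0 -> forall E, E \in faces M -> forall x, hull E x -> peval (m E) x = 0.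
  move=> v0 st0 E /bigcupP[K KM EK] x Ex.
  rewrite -(stab_eq0 d0 simM st0 KM EK Ex).
  have [cE Eind EsubK] := cell_face simM KM EK.
  by apply: (face_proj_eq0 _ d0 cE Eind _ Ex) => y Ey; apply: v0 => //; exact: EsubK.
split=> //; split.
  move=> K KM x Kx; split.
  - by move=> i; apply: vanish; exact: (l2v_eq0 simM p_eq0 KM Kx).
  - by apply: vanish; exact: (phi0 K KM x Kx).
  - by move=> i; apply: vanish; exact: (l2v_eq0 simM q_eq0 KM Kx).
  - exact: u_agree.
move=> E EM x Ex; split; apply: vanish.
  exact: (trace_eq0 _ _ phi0 sphi_eq0 E EM x Ex).
by apply: (trace_eq0 _ _ _ su_eq0 E EM x Ex) => K KM y Ky; exact: u_eq0.
Qed.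

End one_step.

(** The difference of two projections is orthogonal to itself. *)
Lemma W_proj_agree (R : realType) (d : nat) (M : mesh R d) (Om : set 'rV[R]_d)
    (k : nat) (g : 'rV[R]_d -> R) (w w' : pw M) :
  simplicial M -> is_W_proj Om k g w -> is_W_proj Om k g w' -> agree w w'.
Proof.
move=> simM [wW wp] [wW' wp'] K KM x Kx.
have vW : in_W k (pwP (-1) w' w) by move=> L LM; apply: deg_leP; auto.
have v0 : l2w (pwP (-1) w' w) (pwP (-1) w' w) = 0.
  by rewrite l2wP // /l2w wp // wp' // mulN1r addNr.
have := l2w_eq0 simM v0 KM Kx; rewrite pevalP; lra.
Qed.

(** Both discretizations at once: l is the weight of the implicit part of the
    concave term of the potential, the only part that restricts the time step. *)
Lemma hdg_scheme_unique (R : realType) (d : nat) (M : mesh R d)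
    (Om : set 'rV[R]_d) (k : nat) (f : R -> R -> R) (l c eps T : R) (N : nat)
    (g : 'rV[R]_d -> R) :
  (0 < d)%N -> simplicial M -> (forall a b, f a b = a ^+ 3 - l * a - c * b) ->
  0 < eps -> 0 < T -> (0 < N)%N -> l ^+ 2 * (T / N%:R) <= eps ^+ 3 ->
  hdg_unique M Om k f eps T N g.
Proof.
move=> d0 simM fE eps0 T0 N0 lT s s' [s0 sol] [s0' sol'].
have dt0 : 0 < T / N%:R by rewrite divr_gt0 ?ltr0n.
have step n : (0 < n <= N)%N -> agree (su (s n.-1)) (su (s' n.-1)) ->
    same_state (s n) (s' n) /\ agree (su (s n)) (su (s' n)).
  move=> nN ag; have [ss eqs] := sol n nN; have [ss' eqs'] := sol' n nN.
  exact: (step_unique d0 simM fE eps0 dt0 lT ag ss ss' eqs eqs').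
have ag n : (n <= N)%N -> agree (su (s n)) (su (s' n)).
  elim: n => [_|n IH nN]; first exact: W_proj_agree s0 s0'.
  by have [] := step n.+1 nN (IH (ltnW nN)).
move=> n nN; have [] := step n nN => //; apply: ag.
by case/andP: nN => _; exact: leq_trans (leq_pred n).
Qed.

Theorem theorem4p2 (R : realType) (d : nat) (Om : set 'rV[R]_d) (k : nat)
    (T : R) (u0 : 'rV[R]_d -> R) (sigma tau : R) :
  d = 2%N \/ d = 3%N ->
  polyhedral_lipschitz_domain Om ->
  0 < T ->
  L2_on Om u0 ->
  (forall (M : mesh R d) (eps : R) (N : nat),
     triangulation M Om -> shape_regular M sigma -> quasi_uniform M tau ->
     0 < eps -> (1 <= N)%N ->
     hdg_unique M Om k (@f_convex_splitting R) eps T N u0) /\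
  (exists C : R, 0 < C /\
   forall (M : mesh R d) (eps : R) (N : nat),
     triangulation M Om -> shape_regular M sigma -> quasi_uniform M tau ->
     0 < eps -> (1 <= N)%N ->
     T / N%:R <= C * eps ^+ 3 ->
     hdg_unique M Om k (@f_backward_euler R) eps T N u0).
Proof.
move=> d23 _ T0 _; have d0 : (0 < d)%N by case: d23 => ->.
split=> [M eps N [simM _ _] _ _ eps0 N0|].
  apply: (@hdg_scheme_unique _ _ _ _ _ _ 0 1) => //.
    by move=> a b; rewrite /f_convex_splitting; ring.
  by rewrite expr0n /= mul0r exprn_ge0 // ltW.
exists 1; split=> // M eps N [simM _ _] _ _ eps0 N0; rewrite mul1r => dt_le.
apply: (@hdg_scheme_unique _ _ _ _ _ _ 1 0) => //.
  by move=> a b; rewrite /f_backward_euler; ring.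
by rewrite expr1n mul1r.
Qed.
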